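(* Let $n\in\mathbb{N}$, $\beta \in (0,n)$, $p \in [1,+\infty)$, and suppose $f \in L^p(\mathcal{H}^{\beta}_\infty)$. Then for $\mathcal{H}^\beta$-almost every $x\in\mathbb{R}^n$ the function $$f^*(x):= \lim_{r \to 0} \frac{1}{|B(x,r)|}\int_{B(x,r)}f(y)\,dy$$ is well-defined and one has the convergence $$\lim_{r \to 0} \frac{1}{\omega_\beta r^\beta}\int_{B(x,r)}|f-f^*(x)|^p \,d\mathcal{H}^\beta_\infty = 0 .$$
   Context: For $\beta\in(0,n]$ the Hausdorff content of $E\subseteq\mathbb{R}^n$ is $\mathcal{H}^{\beta}_{\infty}(E):= \inf \{\sum_{i=1}^\infty \omega_{\beta} r_i^\beta : E \subset \bigcup_{i=1}^\infty B(x_i,r_i) \}$, where $\omega_\beta:= \pi^{\beta/2}/ \Gamma(\beta/2+1)$ and $B(x,r)$ is the open ball with center $x$ and radius $r$. ''$\mathcal{H}^\beta$-almost every'' means outside a set of zero $\beta$-dimensional Hausdorff measure, equivalently outside a set $N$ with $\mathcal{H}^\beta_\infty(N)=0$. $|B|$ denotes Lebesgue measure and $dy$ integration with respect to it. For an $\mathcal{H}^\beta_\infty$-almost everywhere defined function $g$ with values in $[0,\infty]$, the Choquet integral is $\int_{\mathbb{R}^n} g \, d \mathcal{H}^{\beta}_\infty := \int_0^\infty \mathcal{H}^{\beta}_\infty(\{ g>t\})\,dt$, and $\int_{A} g\,d\mathcal{H}^\beta_\infty:=\int_{\mathbb{R}^n} g\chi_A\,d\mathcal{H}^\beta_\infty$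 for $A\subseteq\mathbb{R}^n$. A function $f$ (real-valued, defined $\mathcal{H}^\beta_\infty$-almost everywhere) is $\mathcal{H}^\beta_\infty$-quasicontinuous if for every $\varepsilon>0$ there is an open set $O$ with $\mathcal{H}^\beta_\infty(O)<\varepsilon$ such that $f$ restricted to $\mathbb{R}^n\setminus O$ is continuous. For $p\in(0,\infty)$, $L^p(\mathcal{H}^{\beta}_{\infty})$ is the set of $\mathcal{H}^{\beta}_{\infty}$-quasicontinuous functions $f$ with $(\int_{\mathbb{R}^n} |f|^p \, d \mathcal{H}^{\beta}_\infty)^{1/p}<\infty$. *)

(* Defs.v *)
From HB Require Import structures.
From mathcomp Require Import all_boot all_order all_algebra.
From mathcomp Require Import all_classical all_reals all_analysis.

Set Implicit Arguments.
Unset Strict Implicit.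
Unset Printing Implicit Defensive.
Import Order.TTheory GRing.Theory Num.Theory.
Import numFieldNormedType.Exports.

Local Open Scope classical_set_scope.
Local Open Scope ring_scope.

(* The library norm on 'rV[R]_n is the sup norm, hence the Euclidean norm and
   the Euclidean balls below; the topology is the same. *)
Definition enorm (R : realType) (n : nat) (x : 'rV[R]_n) : R :=
  Num.sqrt (\sum_(i < n) x ord0 i ^+ 2).

Definition eball (R : realType) (n : nat) (x : 'rV[R]_n) (r : R) : set 'rV[R]_n :=
  [set y | enorm (y - x) < r].

Section lebesgue_measure_on_Rn.
Variables (R : realType) (n : nat).
Implicit Types (Q : 'rV[R]_n * 'rV[R]_n) (A : set 'rV[R]_n).

Definition box Q : set 'rV[R]_n :=
  [set x | forall i, Q.1 ord0 i <= x ord0 i < Q.2 ord0 i].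

(* The maximum with 0 gives the empty boxes volume 0. *)
Definition box_volume Q : R :=
  \prod_(i < n) Num.max 0 (Q.2 ord0 i - Q.1 ord0 i).

(* Covers are countable (possibly finite or empty) families J of boxes. *)
Definition leb_outer A : \bar R :=
  ereal_inf [set (\esum_(Q in J) (box_volume Q)%:E)%E |
             J in [set J | countable J /\ A `<=` \bigcup_(Q in J) box Q]].

Let vol_ge0 Q : (0 <= (box_volume Q)%:E)%E.
Proof. by rewrite lee_fin; apply: prodr_ge0 => i _; rewrite le_max lexx. Qed.

Let leb_outer_ge0 A : (0 <= leb_outer A)%E.
Proof. by apply: le_ereal_inf_tmp => _ [J _ <-]; exact: esum_ge0. Qed.

Let leb_outer0 : leb_outer set0 = 0%E.
Proof.
apply/eqP; rewrite eq_le leb_outer_ge0 andbT.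
apply: ereal_inf_lbound; exists set0; last by rewrite esum_set0.
by split; [exact: countable0|exact: sub0set].
Qed.

Let le_leb_outer : {homo leb_outer : A B / A `<=` B >-> (A <= B)%E}.
Proof.
move=> A B AB; apply: ereal_inf_le_tmp => _ [J [cJ BJ] <-].
by exists J => //; split => //; exact: subset_trans AB BJ.
Qed.

Let esum_bigcup_le (J : nat -> set ('rV[R]_n * 'rV[R]_n)) :
  (\esum_(Q in \bigcup_k J k) (box_volume Q)%:E <=
   \sum_(k <oo) \esum_(Q in J k) (box_volume Q)%:E)%E.
Proof.
rewrite nneseries_esumT; last by move=> k; exact: esum_ge0.
rewrite (esum_esum (a := fun _ Q => (box_volume Q)%:E))//.
have /choice[k kP] : forall Q, exists k, (\bigcup_k J k) Q -> J k Q.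
  move=> Q; have [[k _ JkQ]|nJ] := pselect ((\bigcup_k J k) Q).
    by exists k.
  by exists 0%N => /nJ.
pose e Q := (k Q, Q).
have bij : set_bij (\bigcup_k J k) (e @` (\bigcup_k J k)) e.
  by apply: inj_bij => Q1 Q2 _ _ [].
rewrite -[leLHS](@reindex_esum R _ _ _ _ e (fun x => (box_volume x.2)%:E) bij).
rewrite esum_mkcond [leRHS]esum_mkcond; apply: le_esum => -[m Q] _.
case: ifPn => [/set_mem[Q' JQ' [<- <-]]|_]; last by case: ifP.
by rewrite ifT//; apply/mem_set; split => //=; exact: kP.
Qed.

Let leb_outer_sigma_subadditive : sigma_subadditive leb_outer.
Proof.
move=> A; have [[i ioo]|] := pselect (exists i, leb_outer (A i) = +oo%E).
  by rewrite (eseries_pinfty _ _ ioo) ?leey// => k _; rewrite -ltNye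
    (lt_le_trans _ (leb_outer_ge0 _)).
rewrite -forallNE => Aoo; apply/lee_addgt0Pr => e e0.
rewrite (le_trans _ (epsilon_trick _ _ (ltW e0)))//.
have /choice[J JP] : forall k, exists J, (countable J /\
    A k `<=` \bigcup_(Q in J) box Q) /\
    (\esum_(Q in J) (box_volume Q)%:E <= leb_outer (A k) + (e / (2 ^ k.+1)%:R)%:E)%E.
  move=> k; have ek : 0 < e / (2 ^ k.+1)%:R by rewrite divr_gt0// ltr0n expn_gt0.
  have fink : leb_outer (A k) \is a fin_num.
    by rewrite ge0_fin_numE// ltey; exact/eqP/Aoo.
  have [_ [J JP <-] /ltW ?] := lb_ereal_inf_adherent ek fink.
  by exists J.
apply: (@le_trans _ _ (\esum_(Q in \bigcup_k J k) (box_volume Q)%:E)%E).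
  apply: ereal_inf_lbound; exists (\bigcup_k J k) => //; split.
    by apply: bigcup_countable => // k _; exact: (JP k).1.1.
  move=> x [k _ Akx]; have [Q JkQ Qx] := (JP k).1.2 _ Akx.
  by exists Q => //; exists k.
apply: (le_trans (esum_bigcup_le J)).
by apply: lee_nneseries => k *; [exact: esum_ge0|exact: (JP k).2].
Qed.

HB.instance Definition _ := isOuterMeasure.Build R 'rV[R]_n leb_outer
  leb_outer0 leb_outer_ge0 le_leb_outer leb_outer_sigma_subadditive.

(* Copy of 'rV[R]_n carrying the (complete) sigma-algebra of Lebesgue measurable
   sets, obtained from the outer measure by Caratheodory's criterion. *)
Definition lebT := 'rV[R]_n.

HB.instance Definition _ := Pointed.on lebT.
HB.instance Definition _ := @isMeasurable.Build (caratheodory_display leb_outer)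
  lebT leb_outer.-caratheodory
  (caratheodory_measurable_set0 leb_outer)
  (@caratheodory_measurable_setC _ _ leb_outer)
  (@caratheodory_measurable_bigcup _ _ leb_outer).

Definition leb : set lebT -> \bar R := leb_outer.

Let leb_semi_sigma_additive : semi_sigma_additive leb.
Proof. exact: (@caratheodory_measure_sigma_additive R 'rV[R]_n leb_outer). Qed.

HB.instance Definition _ := isMeasure.Build _ lebT R leb
  leb_outer0 leb_outer_ge0 leb_semi_sigma_additive.

End lebesgue_measure_on_Rn.
Arguments leb {R n}.

Section hausdorff_content.
Variables (R : realType) (n : nat).

Definition gamma (s : R) : R :=
  \int[lebesgue_measure]_(t in `]0, +oo[) (t `^ (s - 1) * expR (- t)).

Definition omega (beta : R) : R := pi `^ (beta / 2) / gamma (beta / 2 + 1).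

(* A ball of radius 0 is empty and costs nothing when beta > 0, so that finite
   covers are allowed as well. *)
Definition hcontent (beta : R) (E : set 'rV[R]_n) : \bar R :=
  ereal_inf [set (\sum_(i <oo) (omega beta * (r i)%:num `^ beta)%:E)%E |
             r in [set r : nat -> {nonneg R} |
                   exists x : nat -> 'rV[R]_n,
                     E `<=` \bigcup_i eball (x i) (r i)%:num]].

Definition choquet (beta : R) (g : 'rV[R]_n -> \bar R) : \bar R :=
  (\int[lebesgue_measure]_(t in `]0%R, +oo[) hcontent beta [set x | t%:E < g x])%E.

Definition choquet_in (beta : R) (A : set 'rV[R]_n) (g : 'rV[R]_n -> \bar R) :
  \bar R := choquet beta (g \_ A).

(* An almost everywhere defined function is a pair (D, f) of its domain D and
   of a total function f whose values outside D are irrelevant: every notion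
   below depends only on the restriction of f to D. *)
Definition quasicontinuous (beta : R) (D : set 'rV[R]_n) (f : 'rV[R]_n -> R) :=
  hcontent beta (~` D) = 0%E /\
  forall eps : R, 0 < eps -> exists O : set 'rV[R]_n,
    [/\ open O, (hcontent beta O < eps%:E)%E & {within D `\` O, continuous f}].

Definition Lp_content (beta p : R) (D : set 'rV[R]_n) (f : 'rV[R]_n -> R) :=
  quasicontinuous beta D f /\
  (poweR (choquet_in beta D (fun y => (`|f y| `^ p)%:E)) p^-1 < +oo)%E.

Definition average (D : set 'rV[R]_n) (f : 'rV[R]_n -> R) (x : 'rV[R]_n) (r : R) : R :=
  (fine (leb (eball x r)))^-1 * \int[leb]_(y in eball x r `&` D) f y.

Definition fstar (D : set 'rV[R]_n) (f : 'rV[R]_n -> R) (x : 'rV[R]_n) : R :=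
  lim (average D f x r @[r --> 0^'+]).

End hausdorff_content.

(* Main.v *)
(* Let [E m] be the set where [|f| ^ p > 2 ^ m], and let [G m] be open with
   content less than [4 ^ -m / 2] and such that [f] is continuous off [G m]. The
   sum of [2 ^ m * hcontent (G m U E m)] is finite because the Choquet integral of
   [|f| ^ p] is. A Vitali argument applied to covers of these sets then shows that
   for almost every [x] the tails of the sum of
   [2 ^ m * hcontent ((G m U E m) n B(x, r))] are at most [t * r ^ beta], uniformly
   in [r], for every [t > 0]. At such a point [x] of the domain, the [p]-th power
   of the oscillation of [f] around [f x] has Choquet integral [o(r ^ beta)] over
   [B(x, r)]. Since Lebesgue measure on [B(x, r)] is at most a constant times
   [r ^ (n - beta)] times the content, the averages of [f] converge to [f x], so
   that [fstar x = f x]. *)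

Require Import Defs.
From HB Require Import structures.
From mathcomp Require Import all_boot all_order all_algebra.
From mathcomp Require Import all_classical all_reals all_analysis.
From mathcomp Require Import measurable_realfun ring lra.
Import Order.TTheory GRing.Theory Num.Theory.
Import numFieldNormedType.Exports.

Set Implicit Arguments.
Unset Strict Implicit.
Unset Printing Implicit Defensive.

Local Open Scope classical_set_scope.
Local Open Scope ring_scope.

(** Content is only subadditive and need not add up over disjoint balls, so the Vitali argument
    cannot be run with the content itself. It is run with point masses at the centres of covering
    balls, which do add up and locally dominate the content. The Choquet integral over [B(x, r)] is
    comparable with a sum over all dyadic levels, so one exceptional set must serve all levels at
    once; hence the density concerns the whole weighted series and not each level. Joining [G m] to
    [E m] lets the same density also exploit continuity: a point outside [G m] has small oscillation
    nearby off [G m], and what remains of [B(x, r)] in [G m] has small content. The factor [4 ^ -m]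
    keeps the contents of the open sets summable against the weights [2 ^ m]. Comparing
    [|f - f x| ^ p] with [|f| ^ p] through level sets avoids any use of additivity of the Choquet
    integral. Finally, Lebesgue measure is given by covers with boxes, so its lower bound on cubes
    has to be established before averages can be controlled. *)

Lemma exists_natinv_le (R : realType) (t : R) : 0 < t ->
  exists j : nat, j.+1%:R^-1 <= t.
Proof.
move=> t0; exists (Num.trunc t^-1).
rewrite -[leRHS]invrK lef_pV2 ?posrE ?invr_gt0//.
exact/ltW/truncnS_gt.
Qed.

(** * Covers and Hausdorff content *)

Section euclidean_balls.
Variables (R : realType) (n : nat).
Implicit Types (x y : 'rV[R]_n) (r : R).

Lemma ler_coord_enorm x i : `|x ord0 i| <= enorm x.
Proof.
rewrite /enorm -sqrtr_sqr ler_wsqrtr// (bigD1 i)//= lerDl.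
by apply: sumr_ge0 => j _; exact: sqr_ge0.
Qed.

Lemma in_ball_coord x r y : 0 < r ->
  ball x r y <-> forall i, `|x ord0 i - y ord0 i| < r.
Proof.
move=> r0; split => [[_ h] i|h]; first exact: h.
by split => // i j; rewrite ord1; exact: h.
Qed.

Lemma enorm_ge0 x : 0 <= enorm x. Proof. exact: sqrtr_ge0. Qed.

Lemma eball_gt0 x r y : eball x r y -> 0 < r.
Proof. exact/le_lt_trans/enorm_ge0. Qed.

Lemma sub_eball_ball x r : eball x r `<=` ball x r.
Proof.
move=> y xry; apply/in_ball_coord; first exact: (eball_gt0 xry).
move=> i; apply: le_lt_trans xry; rewrite distrC.
by have := ler_coord_enorm (y - x) i; rewrite !mxE.
Qed.

(** The factor [n.+1] stands in for the square root of [n]: since [n < n.+1 ^ 2], the inequality is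
    strict, in dimension 0 as well. *)
Lemma sub_ball_eball x r : ball x r `<=` eball x (n.+1%:R * r).
Proof.
move=> y xry; have r0 : 0 < r by case: xry.
move/(in_ball_coord _ _ r0) : xry => h.
have nr0 : 0 < n.+1%:R * r by rewrite mulr_gt0.
rewrite /eball/= /enorm -(ger0_norm (ltW nr0)) -sqrtr_sqr ltr_sqrt; last by rewrite exprn_gt0.
apply: (@le_lt_trans _ _ (\sum_(i < n) r ^+ 2)).
  apply: ler_sum => i _; rewrite -[leLHS]real_normK ?num_real//.
  by rewrite ler_pXn2r ?nnegrE ?(ltW r0)// !mxE distrC ltW.
rewrite sumr_const card_ord -[ltLHS]mulr_natl exprMn ltr_pM2r ?exprn_gt0//.
by rewrite -natrX ltr_nat (leq_trans (ltnSn n))// expnS leq_pmulr// expn_gt0.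
Qed.

End euclidean_balls.

(** Links families indexed by a countable set with the sequences in the definition of content.
    [None] marks indices outside the image of an injection into [nat], so finite and empty families
    need no separate treatment. *)
Lemma esum_countable (R : realType) (T : choiceType) (J : set T) : countable J ->
  exists g : nat -> option T,
  [/\ forall i j, g i = Some j -> J j,
      forall j, J j -> exists i, g i = Some j &
      forall a : T -> \bar R, (forall j, 0 <= a j)%E ->
        (\esum_(j in J) a j = \sum_(i <oo) if g i is Some j then a j else 0)%E].
Proof.
move=> /countable_injP[f finj].
have /choice[g gP] : forall i, exists o : option T,
    if o is Some j then J j /\ f j = i else ~ (f @` J) i.
  move=> i; have [[j Jj fj]|nJ] := pselect ((f @` J) i); last by exists None.
  by exists (Some j).
have gf j : J j -> g (f j) = Some j.
  move=> Jj; have := gP (f j); case: (g (f j)) => [k [Jk fk]|]; last by case; exists j.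
  by congr Some; apply: finj => //; apply/mem_set.
exists g; split.
- by move=> i j gi; have := gP i; rewrite gi => -[].
- by move=> j /gf; exists (f j).
move=> a a0; rewrite nneseries_esumT; last by move=> i; case: (g i).
transitivity (\esum_(i in f @` J) (if g i is Some j then a j else 0))%E.
  rewrite (reindex_esum _ _ _ _ (inj_bij finj)); apply: eq_esum => j Jj.
  by rewrite gf.
rewrite esum_mkcond; apply: eq_esum => i _; case: ifPn => // /negP nJ.
have := gP i; case: (g i) => [j [Jj fj]|//].
by exfalso; apply/nJ/mem_set; exists j.
Qed.

Section content.
Variables (R : realType) (n : nat) (beta : R).
Hypothesis beta0 : 0 < beta.
Local Notation V := ('rV[R]_n).
Local Notation w := (omega beta).
Local Notation H := (@hcontent R n beta).

Lemma omega_ge0 : 0 <= w.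
Proof.
rewrite /omega divr_ge0 ?powR_ge0//; apply: fine_ge0.
apply: integral_ge0 => t _.
by rewrite lee_fin mulr_ge0 ?powR_ge0 ?expR_ge0.
Qed.

Let cost_ge0 r : (0 <= (w * r `^ beta)%:E)%E.
Proof. by rewrite lee_fin mulr_ge0 ?powR_ge0 ?omega_ge0. Qed.

Lemma hcontent_ge0 E : (0 <= H E)%E.
Proof. by apply: le_ereal_inf_tmp => _ [r _ <-]; apply: nneseries_ge0. Qed.

Lemma le_hcontent A B : A `<=` B -> (H A <= H B)%E.
Proof.
move=> AB; apply: ereal_inf_le_tmp => _ [r [x Br] <-].
by exists r => //; exists x; exact: subset_trans Br.
Qed.

Lemma hcontent_le_esum (T : choiceType) (J : set T) (x : T -> V) (r : T -> R) E :
  countable J -> (forall j, J j -> 0 <= r j) ->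
  E `<=` \bigcup_(j in J) eball (x j) (r j) ->
  (H E <= \esum_(j in J) (w * r j `^ beta)%:E)%E.
Proof.
move=> /(@esum_countable R)[g [gJ Jg ->//]] r0 EJ.
pose rn i := if g i is Some j then r j else 0.
have rn0 i : 0 <= rn i by rewrite /rn; case gi : (g i) => [j|//]; exact/r0/(gJ i).
apply: (@le_trans _ _ (\sum_(i <oo) (w * (NngNum (rn0 i))%:num `^ beta)%:E)%E).
  apply: ereal_inf_lbound; exists (fun i => NngNum (rn0 i)) => //.
  exists (fun i => if g i is Some j then x j else 0) => y /EJ[j Jj yj].
  by have [i gi] := Jg j Jj; exists i => //; rewrite /= /rn gi.
apply: lee_nneseries => // i _; rewrite /= /rn; case: (g i) => [//|].
by rewrite powR0 ?gt_eqF// mulr0.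
Qed.

(** Lets covering arguments use the balls of the sup norm, with their triangle inequality; each is
    enclosed in a Euclidean ball with radius multiplied by [n.+1]. *)
Lemma hcontent_le_esum_ball (T : choiceType) (J : set T) (x : T -> V) (r : T -> R) E :
  countable J -> (forall j, J j -> 0 <= r j) ->
  E `<=` \bigcup_(j in J) ball (x j) (r j) ->
  (H E <= \esum_(j in J) (w * n.+1%:R `^ beta * r j `^ beta)%:E)%E.
Proof.
move=> cJ r0 EJ.
apply: (@le_trans _ _ (\esum_(j in J) (w * (n.+1%:R * r j) `^ beta)%:E)%E).
  apply: (hcontent_le_esum (x := x)) => //; first by move=> j /r0 ?; rewrite mulr_ge0.
  by move=> y /EJ[j Jj /sub_ball_eball ?]; exists j.
by apply: le_esum => j /r0 rj; rewrite powRM// mulrA.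
Qed.

Lemma hcontent_cover E (a : \bar R) : (H E < a)%E ->
  exists x : nat -> V, exists r : nat -> R,
  [/\ forall i, 0 <= r i, E `<=` \bigcup_i eball (x i) (r i) &
      (\sum_(i <oo) (w * r i `^ beta)%:E < a)%E].
Proof.
move=> /ereal_inf_lt[_ [r [x Er] <-] ra].
by exists x, (fun i => (r i)%:num).
Qed.

Lemma hcontent_set0 : H set0 = 0%E.
Proof.
apply/eqP; rewrite eq_le hcontent_ge0 andbT.
have := @hcontent_le_esum nat set0 (fun=> 0) (fun=> 0) set0.
by rewrite esum_set0; apply.
Qed.

Lemma hcontent_sigma_subadditive (A : nat -> set V) :
  (H (\bigcup_k A k) <= \sum_(k <oo) H (A k))%E.
Proof.
have [[i ioo]|] := pselect (exists i, H (A i) = +oo%E).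
  by rewrite (eseries_pinfty _ _ ioo) ?leey// => k _; rewrite -ltNye
    (lt_le_trans _ (hcontent_ge0 _)).
rewrite -forallNE => Aoo; apply/lee_addgt0Pr => e e0.
rewrite (le_trans _ (epsilon_trick _ (fun k => hcontent_ge0 (A k)) (ltW e0)))//.
have /choice[x /choice[r xrP]] : forall k, exists (x : nat -> V) (r : nat -> R),
  [/\ forall i, 0 <= r i, A k `<=` \bigcup_i eball (x i) (r i) &
      (\sum_(i <oo) (w * r i `^ beta)%:E < H (A k) + (e / (2 ^ k.+1)%:R)%:E)%E].
  move=> k; apply: hcontent_cover; rewrite lteDl ?lte_fin ?divr_gt0// ?ltr0n ?expn_gt0//.
  by rewrite ge0_fin_numE ?hcontent_ge0// ltey; exact/eqP/Aoo.
apply: (@le_trans _ _ (\sum_(k <oo) \sum_(i <oo) (w * r k i `^ beta)%:E)%E); last first.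
  by apply: lee_nneseries => k *; [exact: nneseries_ge0|have [_ _ /ltW] := xrP k].
rewrite nneseries_esumT; last by move=> k; exact: nneseries_ge0.
under eq_esum do rewrite nneseries_esumT//.
rewrite (esum_esum (a := fun k i => (w * r k i `^ beta)%:E))//.
apply: (hcontent_le_esum (r := fun q => r q.1 q.2) (x := fun q => x q.1 q.2)) .
- exact: countableP.
- by move=> q _; have [] := xrP q.1.
move=> y [k _ Aky]; have [_ Ak _] := xrP k; have [i _ yi] := Ak _ Aky.
by exists (k, i).
Qed.

Lemma hcontentU A B : (H (A `|` B) <= H A + H B)%E.
Proof.
rewrite -bigcup2E (le_trans (hcontent_sigma_subadditive _))//.
rewrite (nneseries_split 0 2); last by move=> k _; exact: hcontent_ge0.
rewrite add0n big_nat_recr//= big_nat1/= eseries0 ?adde0//.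
by move=> [|[|k]]//= _ _; exact: hcontent_set0.
Qed.

Lemma hcontent_bigcup0 (A : nat -> set V) : (forall k, H (A k) = 0%E) ->
  H (\bigcup_k A k) = 0%E.
Proof.
move=> A0; apply/eqP; rewrite eq_le hcontent_ge0 andbT.
by rewrite (le_trans (hcontent_sigma_subadditive _))// eseries0// => k _ _; exact: A0.
Qed.

Lemma hcontent_eball x r : 0 <= r -> (H (eball x r) <= (w * r `^ beta)%:E)%E.
Proof.
move=> r0; have := @hcontent_le_esum nat [set 0%N] (fun=> x) (fun=> r) (eball x r).
rewrite esum_set1//; apply => // y ?; by exists 0%N.
Qed.

End content.

(** * Covering theorem and densities *)

(* Vitali's greedy choice: each selected element comes within a factor 2 of the
   supremum of [s] over the elements not yet met. *)
Lemma greedy_selection (R : realType) (T : Type) (G : set T) (s : T -> R) (S : R)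
    (meet : T -> T -> Prop) :
  (forall y, G y -> 0 < s y <= S) ->
  exists x : nat -> option T,
  [/\ forall i z, x i = Some z -> G z,
      forall i j y z, (i < j)%N -> x i = Some y -> x j = Some z -> ~ meet y z &
      forall y, G y ->
        (exists i z, [/\ x i = Some z, meet z y & s y <= 2 * s z]) \/
        (forall i, exists2 z, x i = Some z & s y <= 2 * s z)].
Proof.
move=> sS; pose elig (A : set T) : set T := [set y | G y /\ forall u, A u -> ~ meet u y].
have /choice[nx nxP] : forall A, exists o : option T,
    if o is Some z then elig A z /\ forall y, elig A y -> s y <= 2 * s z
    else forall y, ~ elig A y.
  move=> A; have [[y ely]|nel] := pselect (exists y, elig A y); last first.
    by exists None => y ely; apply: nel; exists y.
  have hs : has_sup (s @` elig A).
    by split; [exists (s y); exists y|exists S => _ [z [/sS/andP[_ ?] _] <-]].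
  have s0 : 0 < sup (s @` elig A).
    have /sS/andP[sy0 _] := ely.1; apply: (lt_le_trans sy0).
    by apply: ub_le_sup; [exact: hs.2|exists y].
  have [_ [z elz <-] szlt] := sup_adherent (divr_gt0 s0 (ltr0n _ 2)) hs.
  exists (Some z); split => // u elu.
  apply: (@le_trans _ _ (sup (s @` elig A))).
    by apply: ub_le_sup; [exact: hs.2|exists u].
  rewrite -ler_pdivrMl// mulrC; apply/ltW/(le_lt_trans _ szlt).
  by rewrite {2}(splitr (sup _)) addrK.
pose A := fix A i : set T :=
  if i is k.+1 then A k `|` [set z | nx (A k) = Some z] else set0.
have oA i j z : (i < j)%N -> nx (A i) = Some z -> A j z.
  elim: j => // j IH; rewrite ltnS leq_eqVlt => /predU1P[->|ij] oi.
    by right.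
  by left; exact: IH.
have oel i z : nx (A i) = Some z -> elig (A i) z.
  by move=> oi; have := nxP (A i); rewrite oi => -[].
exists (fun i => nx (A i)); split.
- by move=> i z /oel[].
- by move=> i j y z ij oi /oel[_]; apply; exact: oA ij oi.
move=> y Gy.
(* If [y] is eligible at every stage, every choice is made and comes within a factor 2 of [s y].
   Otherwise there is a last stage [k] at which [y] is eligible, and the element chosen there must
   meet [y]. *)
have [all_el|] := pselect (forall i, elig (A i) y).
  right => i; have := nxP (A i); case: (nx (A i)) => [z [_ /(_ _ (all_el i))]|/(_ y)].
    by exists z.
  by have := all_el i.
move=> /existsNP[i0 ni0]; left.
have [k elk nelk] : exists2 k, elig (A k) y & ~ elig (A k.+1) y.
  elim: i0 ni0 => [|i IH] ni; first by exfalso; apply: ni.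
  by have [eli|/IH//] := pselect (elig (A i) y); exists i.
have [z] : exists z, A k.+1 z /\ meet z y.
  apply: contrapT => nz; apply: nelk; split => // u Au mu; apply: nz.
  by exists u.
case=> -[Akz|/= oz] mz; first by have [_ /(_ _ Akz)] := elk.
exists k, z; split => //.
by have := nxP (A k); rewrite oz => -[_]; apply.
Qed.

Section vitali.
Variables (R : realType) (n : nat) (beta : R).
Hypothesis beta0 : 0 < beta.
Local Notation V := ('rV[R]_n).
Local Notation w := (omega beta).
Local Notation H := (@hcontent R n beta).

(* [m] is a discrete measure with an atom [m i] at each point [z i]. *)
Lemma hcontent_vitali (I : choiceType) (J : set I) (z : I -> V) (m : I -> \bar R)
    (G : set V) (t : R) :
  0 < t -> (forall i, 0 <= m i)%E -> (\esum_(i in J) m i < +oo)%E ->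
  (forall x, G x -> exists2 r, 0 < r &
     ((t * r `^ beta)%:E <= \esum_(i in J `&` z @^-1` (ball x r)) m i)%E) ->
  (t%:E * H G <= (w * n.+1%:R `^ beta * 3 `^ beta)%:E * \esum_(i in J) m i)%E.
Proof.
move=> t0 m0 moo GJ.
have esum_sub (A : set I) : A `<=` J -> (\esum_(i in A) m i <= \esum_(i in J) m i)%E.
  move=> AJ; rewrite esum_mkcond [leRHS]esum_mkcond; apply: le_esum => i _.
  case: ifPn => [/set_mem/AJ Ji|_]; first by rewrite mem_set.
  by case: ifP.
have /choice[rho rhoP] : forall x, exists r : R, G x -> 0 < r /\
     ((t * r `^ beta)%:E <= \esum_(i in J `&` z @^-1` (ball x r)) m i)%E.
  move=> x; have [/GJ[r r0 h]|nG] := pselect (G x); first by exists r.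
  by exists 0.
have [M M0 Mdef] : exists2 M : R, 0 <= M & \esum_(i in J) m i = M%:E.
  exists (fine (\esum_(i in J) m i)); first by apply/fine_ge0/esum_ge0.
  by rewrite fineK// ge0_fin_numE//; exact: esum_ge0.
(* The hypothesis on [G] bounds [t * rho y ^ beta] by the total mass [M], so the radii are bounded
   and the greedy choice applies. *)
pose S := (M / t) `^ beta^-1.
have rhoS y : G y -> 0 < rho y <= S.
  move=> /rhoP[r0 h]; rewrite r0/=.
  have : t * rho y `^ beta <= M.
    by rewrite -lee_fin -Mdef; apply: (le_trans h); apply: esum_sub => i [].
  rewrite -ler_pdivlMl// mulrC => h'.
  have <- : (rho y `^ beta) `^ beta^-1 = rho y.
    by rewrite -powRrM mulfV ?gt_eqF// powRr1// ltW.
  by rewrite ge0_ler_powR// ?invr_ge0 ?(ltW beta0)// nnegrE ?powR_ge0// divr_ge0// ltW.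
have [x [xG xdisj xcov]] := greedy_selection
  (fun y u => ball y (rho y) `&` ball u (rho u) !=set0) rhoS.
pose r i := if x i is Some y then rho y else 0.
pose c i := if x i is Some y then y else 0.
pose B i := if x i is Some y then J `&` z @^-1` (ball y (rho y)) else set0.
have r0 i : 0 <= r i.
  by rewrite /r; case E : (x i) => [y|//]; have [/ltW] := rhoP _ (xG _ _ E).
have tB : trivIset setT B.
  apply/trivIsetP => i j _ _; wlog : i j / (i < j)%N.
    move=> h ij; move: (ij); rewrite neq_ltn => /orP[|] lt_ij; first exact: h.
    by rewrite setIC; apply: h => //; rewrite eq_sym.
  move=> ij _; rewrite /B.
  case Ei : (x i) => [y|]; last by rewrite set0I.
  case Ej : (x j) => [u|]; last by rewrite setI0.
  apply/eqP/negPn/negP => /set0P[k [[_ ky] [_ ku]]].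
  by apply: (xdisj _ _ _ _ ij Ei Ej); exists (z k).
(* The selected balls are disjoint, hence carry disjoint portions of the mass. *)
have sumr : (\sum_(i <oo) (t * r i `^ beta)%:E <= M%:E)%E.
  apply: (@le_trans _ _ (\sum_(i <oo) \esum_(k in B i) m k)%E).
    apply: lee_nneseries => [i _ _|i _].
      by rewrite lee_fin mulr_ge0 ?powR_ge0// ltW.
    rewrite /r /B; case Ei : (x i) => [y|]; first exact: (rhoP _ (xG _ _ Ei)).2.
    by rewrite powR0 ?gt_eqF// mulr0 esum_set0.
  rewrite -nneseries_sum_bigcup// -Mdef; apply: esum_sub => k [i _].
  by rewrite /B; case: (x i) => // y [].
(* Only the centre [y] has to be covered, not its whole ball, so the radius
   [rho u + rho y <= 3 * rho u] suffices in place of the usual factor 5. *)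
have cov : G `<=` \bigcup_i ball (c i) (3 * r i).
  move=> y Gy; case: (xcov y Gy) => [[i [u [xi [v [uv yv]] syu]]]|all_big].
    exists i => //; rewrite /c /r xi.
    have -> : 3 * rho u = rho u + 2 * rho u by rewrite -{2}[rho u]mul1r -mulrDl -natr1 addrC.
    have := ball_triangle uv (ball_sym yv).
    by apply: le_ball; rewrite lerD2l.
  (* If all selected radii were at least [rho y / 2], sufficiently many of the disjoint balls would
     together carry more than [M]. *)
  exfalso.
  have ry0 : 0 < t * (rho y / 2) `^ beta.
    by rewrite mulr_gt0// powR_gt0// divr_gt0// (rhoP _ Gy).1.
  have [N MN] : exists N : nat, M < N%:R * (t * (rho y / 2) `^ beta).
    exists (Num.trunc (M / (t * (rho y / 2) `^ beta))).+1.
    by rewrite -ltr_pdivrMr// truncnS_gt.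
  suff : ((N%:R * (t * (rho y / 2) `^ beta))%:E <= M%:E)%E.
    by rewrite lee_fin leNgt MN.
  apply: le_trans sumr; apply: le_trans (nneseries_lim_ge N _); last first.
    by move=> i _ _; rewrite lee_fin mulr_ge0 ?powR_ge0// ltW.
  rewrite sumEFin lee_fin mulr_natl -[in leLHS](card_ord N) -sumr_const big_mkord.
  apply: ler_sum => i _; rewrite ler_pM2l// ge0_ler_powR ?(ltW beta0)// ?nnegrE//.
    by rewrite divr_ge0// ltW// (rhoP _ Gy).1.
  have [u xi syu] := all_big i.
  by rewrite /r xi ler_pdivrMr// mulrC.
have := @hcontent_le_esum_ball R n beta beta0 nat setT c (fun i => 3 * r i) G.
move=> /(_ (countableP _) _ cov) HG.
apply: (@le_trans _ _ (t%:E *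
    \esum_(i in setT) (w * n.+1%:R `^ beta * (3 * r i) `^ beta)%:E)%E).
  by rewrite lee_pmul2l//; apply: HG => i _; rewrite mulr_ge0.
rewrite -nneseries_esumT; last first.
  by move=> i; rewrite lee_fin (mulr_ge0 (mulr_ge0 (omega_ge0 _) _)) ?powR_ge0.
set K := w * _ * _.
have -> : (\sum_(i <oo) (w * n.+1%:R `^ beta * (3 * r i) `^ beta)%:E =
     K%:E * \sum_(i <oo) (r i `^ beta)%:E)%E.
  rewrite -nneseriesZl; last by move=> i _; rewrite lee_fin powR_ge0.
  by apply: eq_eseriesr => i _; rewrite -EFinM powRM// mulrA.
rewrite muleCA lee_wpmul2l//.
  by rewrite lee_fin (mulr_ge0 (mulr_ge0 (omega_ge0 _) _)) ?powR_ge0.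
rewrite -nneseriesZl; last by move=> i _; rewrite lee_fin powR_ge0.
by rewrite Mdef; under eq_eseriesr do rewrite -EFinM.
Qed.
End vitali.

Lemma esumZl_le (R : realType) (T : choiceType) (J : set T) (c : R) (a : T -> \bar R) :
  0 <= c -> (forall j, 0 <= a j)%E ->
  (\esum_(j in J) (c%:E * a j) <= c%:E * (\esum_(j in J) a j))%E.
Proof.
move=> c0 a0; apply: ge_ereal_sup => _ [X [finX XJ] <-].
rewrite -ge0_mule_fsumr//; apply: lee_wpmul2l; first by rewrite lee_fin.
by apply: esum_ge; exists X.
Qed.

Lemma esumZl_ge (R : realType) (T : choiceType) (J : set T) (c : R) (a : T -> \bar R) :
  0 < c -> (forall j, 0 <= a j)%E ->
  (c%:E * (\esum_(j in J) a j) <= \esum_(j in J) (c%:E * a j))%E.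
Proof.
move=> c0 a0; rewrite -lee_pdivlMl//.
have ca0 j : (0 <= c%:E * a j)%E by rewrite mule_ge0// lee_fin ltW.
have ci0 : 0 <= c^-1 by rewrite invr_ge0 ltW.
apply: le_trans (esumZl_le _ ci0 ca0).
by apply: le_esum => j _; rewrite muleA -EFinM mulVf ?mul1e// gt_eqF.
Qed.

Section density.
Variables (R : realType) (n : nat) (beta : R).
Hypothesis beta0 : 0 < beta.
Local Notation V := ('rV[R]_n).
Local Notation w := (omega beta).
Local Notation H := (@hcontent R n beta).

(* Put a mass [2 ^+ m * omega beta * r `^ beta] at the centre of every ball of
   radius [r] of a nearly optimal cover of [A m], for [m >= K]. Outside the union
   of the doubled balls, a ball meeting [eball x s] has radius less than [s] and
   centre in [ball x (2 * s)], so the sum to bound is at most the mass of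
   [ball x (2 * s)]. The total mass tends to 0 with [K], hence so do the contents
   of the doubled balls and, by Vitali, of the points of large density. *)
Lemma hcontent_density (A : nat -> set V) :
  (\sum_(m <oo) (2 ^+ m)%:E * H (A m) < +oo)%E ->
  exists2 N : set V, H N = 0%E & forall x, ~ N x -> forall t : R, 0 < t ->
    exists K, (forall m, (K <= m)%N -> ~ A m x) /\
    forall r : R, 0 < r ->
     (\sum_(K <= m <oo) (2 ^+ m)%:E * H (A m `&` eball x r) <= (t * r `^ beta)%:E)%E.
Proof.
move=> sumA.
have p2 m : 0 < 2 ^+ m :> R by rewrite exprn_gt0.
have cost_ge0 (r : R) : (0 <= (w * r `^ beta)%:E)%E.
  by rewrite lee_fin (mulr_ge0 (omega_ge0 _)) ?powR_ge0.
have HA m : H (A m) \is a fin_num.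
  rewrite ge0_fin_numE ?hcontent_ge0// ltey; apply/eqP => Am.
  move: sumA; rewrite (@nneseries_pinfty _ _ _ m)//.
    by move=> k _; rewrite mule_ge0 ?hcontent_ge0// lee_fin ltW.
  by rewrite Am gt0_muley// lte_fin.
(* The slack contains [2 ^- m] so that it is still summable, with sum at most 1, after
   multiplication by the weight [2 ^+ m]. *)
have /choice[z /choice[r zrP]] : forall m, exists (z : nat -> V) (r : nat -> R),
  [/\ forall i, 0 <= r i, A m `<=` \bigcup_i eball (z i) (r i) &
      (\sum_(i <oo) (w * r i `^ beta)%:E < H (A m) + (2 ^- m * (1 / (2 ^ m.+1)%:R))%:E)%E].
  move=> m; apply: hcontent_cover; rewrite lteDl// lte_fin.
pose W (q : nat * nat) : \bar R := (2 ^+ q.1 * (w * r q.1 q.2 `^ beta))%:E.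
have W0 q : (0 <= W q)%E by rewrite /W EFinM mule_ge0// lee_fin ltW.
have rowW m : (\sum_(i <oo) W (m, i) = (2 ^+ m)%:E * \sum_(i <oo) (w * r m i `^ beta)%:E)%E.
  by rewrite -nneseriesZl.
pose J K : set (nat * nat) := [set q | (K <= q.1)%N].
pose T K := (\esum_(q in J K) W q)%E.
have TE K : T K = (\sum_(K <= m <oo) \sum_(i <oo) W (m, i))%E.
  rewrite ereal_series nneseries_esum; last by move=> m _; exact: nneseries_ge0.
  under [RHS]eq_esum do rewrite nneseries_esumT//.
  rewrite (esum_esum (a := fun k i => W (k, i)))// /T.
  rewrite (_ : J K = [set x | (K <= x)%N] `*`` (fun=> setT)).
    by apply: eq_esum => -[].
  by apply/seteqP; split => -[a b]//= [].
have sumW : (\sum_(m <oo) \sum_(i <oo) W (m, i) < +oo)%E.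
  apply: (@le_lt_trans _ _ (\sum_(m <oo) ((2 ^+ m)%:E * H (A m) + (1 / (2 ^ m.+1)%:R)%:E))%E).
    apply: lee_nneseries => [m _ _|m _]; first exact: nneseries_ge0.
    have [_ _ /ltW] := zrP m; rewrite rowW => h.
    apply: (le_trans (lee_wpmul2l _ h)); first by rewrite lee_fin ltW.
    by rewrite muleDr// ?fin_num_adde_defr// -EFinM mulVKf// gt_eqF.
  apply: le_lt_trans (epsilon_trick _ _ ler01) _.
    by move=> m; rewrite mule_ge0 ?hcontent_ge0// lee_fin ltW.
  by rewrite lte_add_pinfty// ltry.
have Tcvg : T K @[K --> \oo] --> 0%E.
  under eq_fun do rewrite TE.
  by apply: nneseries_tail_cvg => // m _; exact: nneseries_ge0.
have Tfin K : (T K < +oo)%E.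
  apply: le_lt_trans sumW; rewrite TE ereal_series.
  by apply: subset_lee_nneseries => // m _; exact: nneseries_ge0.
pose F K : set V := \bigcup_(q in J K) ball (z q.1 q.2) (2 * r q.1 q.2).
pose mass K (x : V) (s : R) :=
  (\esum_(q in J K `&` (fun q => z q.1 q.2) @^-1` (ball x s)) W q)%E.
pose G (t : R) K : set V := [set x : V | exists2 s : R, 0 < s &
   ((t * s `^ beta)%:E < mass K x (2 * s)%R)%E].
have rge0 q : 0 <= r q.1 q.2 by have [] := zrP q.1.
pose C1 := n.+1%:R `^ beta * 2 `^ beta : R.
have C10 : 0 <= C1 by rewrite mulr_ge0 ?powR_ge0.
have HF K : (H (F K) <= C1%:E * T K)%E.
  apply: (le_trans (@hcontent_le_esum_ball _ _ _ beta0 _ (J K) _ _ _ _ _ (@subset_refl _ _))).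
  - exact: countableP.
  - by move=> q _; rewrite mulr_ge0.
  apply: le_trans (esumZl_le _ C10 W0); apply: le_esum => q _.
  rewrite -EFinM lee_fin powRM//; set a := n.+1%:R `^ beta; set b := 2 `^ beta.
  set c := _ `^ beta.
  have -> : w * a * (b * c) = C1 * (w * c) by rewrite (mulrC w a) mulrACA.
  rewrite ler_wpM2l// ler_peMl ?exprn_ege1 ?ler1n//.
  by have := cost_ge0 (r q.1 q.2); rewrite lee_fin.
(* [3 ^ beta] comes from the Vitali bound, and [2 ^ beta] from measuring the mass in
   [ball x (2 * s)] against [s ^ beta]. *)
pose C2 := w * n.+1%:R `^ beta * 3 `^ beta * 2 `^ beta : R.
have C20 : 0 <= C2 by rewrite (mulr_ge0 (mulr_ge0 (mulr_ge0 (omega_ge0 _) _) _)) ?powR_ge0.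
have HG (t : R) K : 0 < t -> (t%:E * H (G t K) <= C2%:E * T K)%E.
  move=> t0; set b := 2 `^ beta; have b0 : 0 < b by rewrite powR_gt0.
  have := @hcontent_vitali R n beta beta0 _ (J K) (fun q => z q.1 q.2) W (G t K)
    (t / b) (divr_gt0 t0 b0) W0 (Tfin K).
  have -> : t%:E = (b%:E * (t / b)%:E)%E by rewrite -EFinM mulrC mulfVK// gt_eqF.
  rewrite -muleA /C2 -/b (mulrC _ b) (EFinM b) -(muleA b%:E) => h.
  rewrite lee_pmul2l ?lte_fin//; apply: h => x [s s0 /ltW h].
  exists (2 * s); first by rewrite mulr_gt0.
  by rewrite powRM ?(ltW s0)// -/b mulrA mulfVK ?gt_eqF.
(* A point outside [S t] avoids both bad sets for some [K]. The content of [S t] vanishes because it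
   is bounded, up to a constant depending on [t], by [T K] for every [K]. Taking [t = 1 / j.+1] then
   gives one null set valid for all [t]. *)
pose S t := \bigcap_K (F K `|` G t K).
have HS (t : R) : 0 < t -> H (S t) = 0%E.
  move=> t0; apply/eqP; rewrite eq_le hcontent_ge0 andbT.
  rewrite -(@pmule_rle0 _ t%:E) ?lte_fin//.
  have : ((t * C1 + C2)%:E * T K)%E @[K --> \oo] --> ((t * C1 + C2)%:E * 0)%E.
    exact: cvgeZl.
  rewrite mule0 => cv; rewrite -(cvg_lim _ cv)//; apply: lime_ge.
    by apply/cvg_ex; eexists; exact: cv.
  apply: nearW => K; apply: (@le_trans _ _ (t%:E * (H (F K) + H (G t K)))%E).
    rewrite lee_pmul2l ?lte_fin//; apply: le_trans (hcontentU beta0 _ _) => //.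
    by apply: le_hcontent => x; exact.
  rewrite ge0_muleDr ?hcontent_ge0// EFinD ge0_muleDl ?lee_fin ?(mulr_ge0 (ltW t0) C10)//.
  by rewrite leeD// ?HG// EFinM -muleA lee_pmul2l ?lte_fin// HF.
exists (\bigcup_j S (j.+1%:R^-1)).
  by apply: hcontent_bigcup0 => // j; apply: HS; rewrite invr_gt0.
move=> x nx t t0.
have [j jt] : exists j : nat, (j.+1%:R)^-1 <= t.
  exact: exists_natinv_le.
have /existsNP[K /not_implyP[_ /not_orP[nF nG]]] : ~ S (j.+1%:R^-1) x.
  by move=> Sx; apply: nx; exists j.
exists K; split => [m Km Amx|s s0].
  apply: nF; have [_ /(_ _ Amx)[i _ xi] _] := zrP m.
  exists (m, i) => //=; move: (sub_eball_ball xi); apply: le_ball.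
  by apply: ler_peMl; [exact: (rge0 (m, i))|rewrite ler1n].
apply: (@le_trans _ _ (mass K x (2 * s))); last first.
  apply: (@le_trans _ _ (j.+1%:R^-1 * s `^ beta)%:E).
    by rewrite leNgt; apply/negP => h; apply: nG; exists s.
  by rewrite lee_fin ler_wpM2r ?powR_ge0.
pose L m : set nat := [set i | ball x (2 * s) (z m i)].
have -> : (mass K x (2 * s)%R = \sum_(K <= m <oo) \esum_(i in L m) W (m, i))%E.
  rewrite ereal_series nneseries_esum; last by move=> m _; exact: esum_ge0.
  rewrite (esum_esum (a := fun k i => W (k, i)))//.
rewrite 2!ereal_series [leLHS]nneseries_esum; last first.
  by move=> m _; rewrite mule_ge0 ?hcontent_ge0// lee_fin ltW.
rewrite [leRHS]nneseries_esum; last by move=> m _; exact: esum_ge0.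
apply: le_esum => m /= Km.
have -> : (\esum_(i in L m) W (m, i) =
    \esum_(i in L m) ((2 ^+ m)%:E * (w * r m i `^ beta)%:E))%E by [].
apply: le_trans (esumZl_ge _ (p2 m) _); last by [].
rewrite lee_pmul2l ?lte_fin//.
apply: (hcontent_le_esum beta0 (x := z m)).
- exact: countableP.
- by move=> i _; exact: (rge0 (m, i)).
move=> y [Amy xy]; have [_ /(_ _ Amy)[i _ yi] _] := zrP m.
have h : ball x (s + r m i) (z m i).
  by apply: (ball_triangle (sub_eball_ball xy)); exact/ball_sym/sub_eball_ball.
have [rs|sr] := leP (r m i) s.
  by exists i => //; move: h; apply: le_ball; rewrite mulr_natl mulr2n lerD2l.
exfalso; apply: nF; exists (m, i) => //=; apply/ball_sym; move: h.
by apply: le_ball; rewrite mulr_natl mulr2n lerD2r ltW.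
Qed.
End density.

(** * Dyadic sums and integrals *)

Section integral_cover.
Local Open Scope ereal_scope.
Context d (T : measurableType d) (R : realType) (mu : {measure set T -> \bar R}).

(** On [D], [g] is dominated by the series of the [c k] times the indicators of the [I k]. Overlaps
    only increase that series, so the pieces need not be disjoint. *)
Lemma ge0_integral_le_cover (D : set T) (g : T -> \bar R) (c : nat -> \bar R)
    (I : nat -> set T) :
  measurable D -> measurable_fun D g -> (forall t, D t -> 0 <= g t) ->
  (forall k, 0 <= c k) -> (forall k, measurable (I k)) ->
  (forall t, D t -> exists2 k, I k t & g t <= c k) ->
  \int[mu]_(t in D) g t <= \sum_(k <oo) c k * mu (I k).
Proof.
move=> mD mg g0 c0 mI cov.
have mcI k : measurable_fun D (fun t => c k * (\1_(I k) t)%:E).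
  by apply: measurable_funeM; apply/measurable_EFinP; exact: measurable_indic.
have cI0 k t : 0 <= c k * (\1_(I k) t)%:E by rewrite mule_ge0.
apply: (@le_trans _ _ (\int[mu]_(t in D) \sum_(k <oo) c k * (\1_(I k) t)%:E)).
  apply: ge0_le_integral => //.
    by apply: ge0_emeasurable_sum.
  move=> t /cov[k Ikt gk]; apply: (le_trans gk).
  rewrite (nneseriesD1 (n := k))//=.
  rewrite indicE mem_set// mule1 leeDl//; exact: nneseries_ge0.
rewrite integral_nneseries//; apply: lee_nneseries => [k _ _|k _].
  exact: integral_ge0.
rewrite ge0_integralZl//; last by apply/measurable_EFinP; exact: measurable_indic.
by rewrite lee_wpmul2l// integral_indic// le_measure ?inE//; exact: measurableI.
Qed.

End integral_cover.

Section dyadic.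
Local Open Scope ereal_scope.
Variables (R : realType) (phi : R -> \bar R).
Hypothesis phi0 : forall t, 0 <= phi t.
Hypothesis phi_noninc : {homo phi : s t / (s <= t)%R >-> t <= s}.
Local Notation mu := (@lebesgue_measure R).

Lemma nonincreasing_emeasurable (D : set R) : measurable D -> measurable_fun D phi.
Proof.
move=> mD; apply: (measurability (@ErealGenCInfty.G R)) => [|/= _ [_] [r] -> <-].
  exact: ErealGenCInfty.measurableE.
apply: measurableI => //; apply: is_interval_measurable => s t/=.
rewrite !in_itv/= !andbT => fs ft u /andP[su ut].
by rewrite in_itv/= andbT (le_trans ft)// phi_noninc.
Qed.

(** With [a m = delta * 2 ^+ m], the term of index [m] is twice the area of the rectangle of height
    [phi (a m)] over []a m / 2, a m]]. By monotonicity it lies below the graph of [phi], and these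
    intervals are disjoint. *)
Lemma nneseries_dyadic_le (delta : R) : (0 < delta)%R ->
  \sum_(m <oo) (delta * 2 ^+ m)%:E * phi (delta * 2 ^+ m) <=
  2%:E * \int[mu]_(t in `]0%R, +oo[) phi t.
Proof.
move=> d0; pose a m : R := (delta * 2 ^+ m)%R.
have a0 m : (0 < a m)%R by rewrite mulr_gt0// exprn_gt0.
have aS m : a m.+1 = (a m * 2)%R by rewrite /a exprSr mulrA.
pose I m := `](a m / 2)%R, a m]%classic.
have tI : trivIset setT I.
  apply/trivIsetP => i j _ _; wlog : i j / (i < j)%N.
    move=> h ij; move: (ij); rewrite neq_ltn => /orP[|] lt_ij; first exact: h.
    by rewrite setIC; apply: h => //; rewrite eq_sym.
  move=> ij _; apply/seteqP; split => // t [].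
  rewrite /I /= !in_itv/= => /andP[_ ta] /andP[at' _].
  have : (t < t)%R; last by rewrite ltxx.
  apply: (le_lt_trans ta); apply: (le_lt_trans _ at').
  case: j ij at' => // j; rewrite ltnS => ij _; rewrite aS mulfK//.
  by rewrite ler_pM2l// ler_weXn2l// ler1n.
have mI m : measurable (I m) by exact: measurable_itv.
have subI : \bigcup_m I m `<=` `]0%R, +oo[.
  move=> t [m _] /=; rewrite !in_itv/= andbT => /andP[at' _].
  by apply: le_lt_trans at'; rewrite divr_ge0// ltW.
apply: (@le_trans _ _ (2%:E * \int[mu]_(t in \bigcup_m I m) phi t)); last first.
  rewrite lee_pmul2l//; apply: ge0_subset_integral => //.
    exact: bigcupT_measurable.
  exact: nonincreasing_emeasurable.
rewrite ge0_integral_bigcup//; last first.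
  by apply: nonincreasing_emeasurable; exact: bigcupT_measurable.
rewrite -nneseriesZl; last by move=> m _; exact: integral_ge0.
apply: lee_nneseries => [m _ _|m _].
  by rewrite mule_ge0// lee_fin ltW// (a0 m).
apply: (@le_trans _ _ (2%:E * \int[mu]_(t in I m) cst (phi (a m)) t)); last first.
  rewrite lee_pmul2l//; apply: ge0_le_integral => //.
  - exact: mI.
  - by move=> t _ /=.
  - by apply: nonincreasing_emeasurable; exact: mI.
  - by move=> t; rewrite /I/= in_itv/= => /andP[_ ta]; exact: phi_noninc.
have lenI : mu (I m) = (a m - a m / 2)%:E.
  by rewrite /I lebesgue_measure_itv/= lte_fin ltr_pdivrMr// ltr_pMr// ltr1n.
rewrite integral_cst/=; last exact: mI.
rewrite [X in _ * (_ * X)]lenI.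
have -> : (a m - a m / 2 = a m / 2)%R by rewrite {1}(splitr (a m)) addrK.
by rewrite muleCA -EFinM (mulrC 2%R) mulfVK// muleC.
Qed.

(** The three terms come from []0, e]], []0, 2 ^+ K]] and the intervals []2 ^+ m, 2 ^+ m.+1]] with
    [m >= K]. The second interval starts at 0 so that [e] and [2 ^+ K] need not be ordered. *)
Lemma integral_le_dyadic (b : \bar R) (e : R) (K : nat) :
  (0 < e)%R -> (forall t : R, (0 < t)%R -> phi t <= b) ->
  \int[mu]_(t in `]0%R, +oo[) phi t <=
  e%:E * b + (2 ^+ K)%:E * phi e + \sum_(K <= m <oo) (2 ^+ m)%:E * phi (2 ^+ m).
Proof.
move=> e0 phib.
have b0 : 0 <= b by apply: le_trans (phib _ (@ltr01 _)).
pose c k := match k with 0%N => b | 1%N => phi e | k.+2 => phi (2 ^+ (k + K)) end.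
pose I k : set R := match k with 0%N => `]0%R, e]%classic | 1%N => `]0%R, (2 ^+ K)%R]%classic
  | k.+2 => `](2 ^+ (k + K))%R, (2 ^+ (k + K).+1)%R]%classic end.
have c0 k : 0 <= c k by case: k => [|[|k]]//=.
have mI k : measurable (I k) by case: k => [|[|k]]; exact: measurable_itv.
have mphi : measurable_fun (`]0%R, +oo[%classic : set R) phi by exact: nonincreasing_emeasurable.
apply: (le_trans (@ge0_integral_le_cover _ _ R mu _ _ c I (measurable_itv _) mphi _ c0 mI _)) => //.
  move=> t /=; rewrite in_itv/= andbT => t0.
  have [te|et] := leP t e; first by exists 0%N; rewrite /= ?phib// in_itv/= t0.
  have [tK|Kt] := leP t (2 ^+ K)%R.
    by exists 1%N; rewrite /= ?in_itv/= ?t0//; exact/phi_noninc/ltW.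
  have [k kt tk] : exists2 k, (2 ^+ (k + K) < t)%R & (t <= 2 ^+ (k + K).+1)%R.
    have : exists k : nat, (t <= 2 ^+ (k + K).+1)%R.
      exists (Num.trunc t).+1; apply: (le_trans (ltW (truncnS_gt t))).
      rewrite -natrX ler_nat (leq_trans (ltnW (ltn_expl _ (isT : (1 < 2)%N))))//.
      by rewrite leq_exp2l// ltnW// ltnS leq_addr.
    move=> /ex_minnP[k tk mink]; exists k => //.
    case: k mink tk => [|k] mink tk //.
    rewrite ltNge; apply/negP => h; have := mink k.
    by rewrite h ltnn => /(_ isT).
  by exists k.+2; rewrite /= ?in_itv/= ?kt//; exact/phi_noninc/ltW.
have cI0 k : 0 <= c k * mu (I k) by rewrite mule_ge0.
have lenI (u v : R) : (u <= v)%R -> mu `]u, v]%classic = (v - u)%:E.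
  move=> uv; rewrite lebesgue_measure_itv/= lte_fin -EFinD.
  by case: ltgtP uv => // -> _; rewrite subrr.
rewrite (nneseries_split 0 2)// add0n big_nat_recr//= big_nat1/=.
rewrite (lenI 0%R e (ltW e0)) (lenI 0%R (2 ^+ K)%R) ?exprn_ge0// !subr0 leeD//.
  by rewrite muleC leeD// muleC.
rewrite -(nneseries_addn 2)// -(nneseries_addn K); last first.
  by move=> i; rewrite mule_ge0// lee_fin exprn_ge0.
apply: lee_nneseries => k _; first by rewrite cI0.
rewrite addn2 /= lenI; last by rewrite ler_weXn2l// ler1n.
by rewrite muleC exprS mulr_natl mulr2n addrK.
Qed.

End dyadic.

(** * Lebesgue measure of boxes and balls *)

Section box_volume.
Variables (R : realType) (n : nat).
Local Notation V := ('rV[R]_n).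
Implicit Types (P Q : V * V).
Local Notation len P k := (Num.max 0 (P.2 ord0 k - P.1 ord0 k)).
Local Notation mem P k t := (P.1 ord0 k <= t < P.2 ord0 k).

Lemma box_volume_ge0 Q : 0 <= box_volume Q.
Proof. by apply: prodr_ge0 => i _; rewrite le_max lexx. Qed.

(* The lower bound integrates out the coordinates one at a time, so it needs no
   compactness: [mixed P x m] is the indicator of the box [P] with its first [m]
   coordinates integrated and the others frozen at [x]. *)
Let mixed P (x : V) (m : nat) : R :=
  \prod_(k < n) (if (k < m)%N then len P k else (mem P k (x ord0 k))%:R).

Let mixedS P (x : V) m (mn : (m < n)%N) (k := Ordinal mn) :
  exists2 c, 0 <= c &
  (forall t, mixed P (\row_j (if j == k then t else x ord0 j)) m = c * (mem P k t)%:R) /\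
  (mixed P x m.+1 = c * len P k).
Proof.
exists (\prod_(j < n | j != k) (if (j < m)%N then len P j else (mem P j (x ord0 j))%:R)).
  by apply: prodr_ge0 => j _; case: ifP => // _; rewrite le_max lexx.
split => [t|]; rewrite /mixed (bigD1 k)//= mulrC.
  rewrite ltnn mxE eqxx; congr (_ * _); apply: eq_bigr => j /negbTE jk.
  by rewrite mxE jk.
rewrite ltnSn; congr (_ * _); apply: eq_bigr => j jk.
by rewrite ltnS leq_eqVlt -val_eqE/= in jk *; rewrite (negbTE jk).
Qed.

Let lower_mixed (P : nat -> V * V) (c : nat -> R) Q m : (m <= n)%N ->
  (forall i, 0 <= c i) ->
  (forall x, box Q x -> (1 <= \sum_(i <oo) (c i * mixed (P i) x 0)%:E)%E) ->
  forall x, box Q x ->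
  ((\prod_(k < n) (if (k < m)%N then len Q k else 1))%:E <=
    \sum_(i <oo) (c i * mixed (P i) x m)%:E)%E.
Proof.
move=> + c0 cov; elim: m => [_ x Qx|m IH mn x Qx].
  by rewrite big1 ?cov.
(* Freeing coordinate [k] of [x], the inequality of stage [m] is integrated along side [k] of [Q];
   the integral is exchanged with the nonnegative series. *)
pose k := Ordinal mn; pose xt t : V := \row_j (if j == k then t else x ord0 j).
have /choice[d dP] : forall i, exists d, [/\ 0 <= d,
    (forall t, mixed (P i) (xt t) m = d * (mem (P i) k t)%:R) &
    (mixed (P i) x m.+1 = d * len (P i) k)].
  by move=> i; have [d d0 [d1 d2]] := mixedS (P i) x mn; exists d.
pose I (B : V * V) : set R := `[B.1 ord0 k, B.2 ord0 k[%classic.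
have lenI B : lebesgue_measure (I B) = (len B k)%:E :> \bar R.
  rewrite /I lebesgue_measure_itv/= lte_fin.
  by case: ltP => h; rewrite -?EFinD; [rewrite max_r// subr_ge0 ltW|rewrite max_l// subr_le0].
set A := \prod_(j < n) (if (j < m)%N then len Q j else 1).
have A0 : 0 <= A by apply: prodr_ge0 => j _; case: ifP => // _; rewrite le_max lexx.
have -> : \prod_(j < n) (if (j < m.+1)%N then len Q j else 1) = A * len Q k.
  rewrite /A (bigD1 k)//= ltnSn [in RHS](bigD1 k)//= ltnn mul1r mulrC; congr (_ * _).
  apply: eq_bigr => j jk.
  by rewrite ltnS leq_eqVlt -val_eqE/= in jk *; rewrite (negbTE jk).
have cd0 i : 0 <= c i * d i by rewrite mulr_ge0//; have [] := dP i.
have mI B : measurable (I B) by exact: measurable_itv.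
have mf i : measurable_fun (I Q) (fun t => (c i * d i)%:E * (\1_(I (P i)) t)%:E)%E.
  by apply: measurable_funeM; apply/measurable_EFinP; exact: measurable_indic.
rewrite EFinM -lenI -(integral_cst lebesgue_measure (mI Q) A%:E).
apply: (@le_trans _ _ (\int[lebesgue_measure]_(t in I Q)
    \sum_(i <oo) ((c i * d i)%:E * (\1_(I (P i)) t)%:E))%E).
  apply: ge0_le_integral => //.
  - exact: mI.
  - apply: (@ge0_emeasurable_sum _ _ _ _ _ xpredT) => [i t _ _|i _]; last exact: mf.
    by rewrite mule_ge0// lee_fin.
  move=> t; rewrite /I/= in_itv/= => Qt.
  apply: (le_trans (IH (ltnW mn) (xt t) _)).
    by move=> j; rewrite mxE; case: eqP => [->//|_]; exact: Qx.
  rewrite le_eqVlt; apply/orP; left; apply/eqP; apply: eq_eseriesr => i _.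
  have [_ -> _] := dP i; rewrite mulrA -EFinM indicE; congr (_ * (nat_of_bool _)%:R)%:E.
  by apply/idP/idP => [h|/set_mem/=]; [apply/mem_set => /=; rewrite in_itv|rewrite in_itv].
rewrite integral_nneseries; last 3 first.
- exact: mI.
- exact: mf.
- by move=> i t _; rewrite mule_ge0// lee_fin.
apply: lee_nneseries => [i _ _|i _].
  by apply: integral_ge0 => t _; rewrite mule_ge0// lee_fin.
have [_ _ ->] := dP i.
rewrite ge0_integralZl_EFin; last 4 first.
- exact: mI.
- by move=> t _; rewrite lee_fin.
- by apply/measurable_EFinP; apply: measurable_indic; exact: mI.
- exact: cd0.
rewrite mulrA [leRHS]EFinM lee_wpmul2l ?lee_fin// integral_indic; [|exact: mI..].
by rewrite -lenI le_measure ?inE//; [apply: measurableI; exact: mI|exact: mI].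
Qed.

(** The weights [c] allow an enumeration of boxes to be padded with terms of weight 0. Padding with
    empty boxes would fail in dimension 0, where every box is the whole space and has volume 1. *)
Lemma box_volume_le_series (P : nat -> V * V) (c : nat -> R) Q :
  (forall i, 0 <= c i) ->
  (forall x, box Q x -> (1 <= \sum_(i <oo) (c i * (x \in box (P i))%:R)%:E)%E) ->
  ((box_volume Q)%:E <= \sum_(i <oo) (c i * box_volume (P i))%:E)%E.
Proof.
move=> c0 cov; have [Q0|/existsNP[k nk]] := pselect (forall k, Q.1 ord0 k < Q.2 ord0 k); last first.
  rewrite {1}/box_volume (bigD1 k)//= max_l ?mul0r; last first.
    by rewrite subr_le0 leNgt; apply/negP.
  by apply: nneseries_ge0 => i _ _; rewrite lee_fin mulr_ge0// box_volume_ge0.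
(* [lower_mixed] must be applied at some point of the box; at stage [n] nothing depends on that
   point any more. *)
have Q1 : box Q Q.1 by move=> k; rewrite lexx Q0.
have mixed0 P' x : mixed P' x 0 = (x \in box P')%:R.
  have [/set_mem h|h] := boolP (x \in box P').
    by rewrite /mixed big1// => k _; rewrite /= h.
  have /existsNP[k /negP nk] : ~ box P' x by move=> ?; move/negP : h; apply; exact/mem_set.
  by rewrite /mixed (bigD1 k)//= (negbTE nk) mul0r.
have mixedn P' x : mixed P' x n = box_volume P'.
  by apply: eq_bigr => k _; rewrite ltn_ord.
have := @lower_mixed P c Q n (leqnn n) c0 _ Q.1 Q1.
rewrite (eq_bigr (fun k => len Q k)); last by move=> k _; rewrite ltn_ord.
under eq_eseriesr do rewrite mixedn.
by apply => x Qx; under eq_eseriesr do rewrite mixed0; exact: cov.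
Qed.

Lemma box_volume_le_leb Q : ((box_volume Q)%:E <= leb (box Q))%E.
Proof.
apply: le_ereal_inf_tmp => _ [J [/(@esum_countable R)[g [gJ Jg gE]] QJ] <-].
rewrite gE; last by move=> P; rewrite lee_fin box_volume_ge0.
pose c i : R := if g i is Some _ then 1 else 0.
pose P i : V * V := if g i is Some P then P else 0.
have -> : (\sum_(i <oo) (if g i is Some j then (box_volume j)%:E else 0) =
    \sum_(i <oo) (c i * box_volume (P i))%:E)%E.
  by apply: eq_eseriesr => i _; rewrite /c /P; case: (g i) => [?|]; rewrite ?mul1r ?mul0r.
apply: box_volume_le_series => [i|x /QJ[P' JP' xP']]; first by rewrite /c; case: (g i).
have [i gi] := Jg _ JP'.
rewrite (nneseriesD1 (n := i))//; last first.
  by move=> k _; rewrite lee_fin mulr_ge0// /c; case: (g k).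
rewrite {1}/c {1}/P gi mul1r mem_set// leeDl//.
by apply: nneseries_ge0 => k _ _; rewrite lee_fin mulr_ge0// /c; case: (g k).
Qed.

End box_volume.

Section lebesgue_outer.
Variables (R : realType) (n : nat).
Local Notation V := ('rV[R]_n).
Implicit Types (Q : V * V) (A B : set V).

(** A cover in [leb_outer] is a set of boxes, so a box repeated in the family counts once. The
    section [s] keeps one index per box, and the other indices only increase the right-hand side. *)
Lemma leb_le_esum (T : choiceType) (J : set T) (Q : T -> V * V) A :
  countable J -> A `<=` \bigcup_(j in J) box (Q j) ->
  (leb A <= \esum_(j in J) (box_volume (Q j))%:E)%E.
Proof.
move=> cJ AJ; have vol0 j : (0 <= (box_volume (Q j))%:E)%E by rewrite lee_fin box_volume_ge0.
have [J0|/set0P[j0 Jj0]] := eqVneq J set0.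
  rewrite [leLHS](_ : _ = 0%E) ?esum_ge0//.
  apply/eqP; rewrite eq_le measure_ge0 andbT.
  apply: ereal_inf_lbound; exists set0; last by rewrite esum_set0.
  by split; [exact: countable0|move: AJ; rewrite J0 !bigcup_set0].
have /choice[s sP] : forall P, exists j, (Q @` J) P -> J j /\ Q j = P.
  move=> P; have [[j Jj QjP]|nP] := pselect ((Q @` J) P); first by exists j.
  by exists j0.
apply: (@le_trans _ _ (\esum_(P in Q @` J) (box_volume P)%:E)%E).
  apply: ereal_inf_lbound; exists (Q @` J) => //; split.
    exact/(sub_countable _ cJ)/card_image_le.
  by move=> x /AJ[j Jj xj]; exists (Q j) => //; exists j.
have -> : (\esum_(P in Q @` J) (box_volume P)%:E =
    \esum_(P in Q @` J) (box_volume (Q (s P)))%:E)%E.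
  by apply: eq_esum => P /sP[_ ->].
rewrite -(esum_image (Q @` J) s (fun j => (box_volume (Q j))%:E)); last first.
  by move=> P P' /set_mem/sP[_ h] /set_mem/sP[_ h'] ss; rewrite -h -h' ss.
rewrite esum_mkcond [leRHS]esum_mkcond; apply: le_esum => j _.
case: ifPn => [/set_mem[P /sP[Jj _] <-]|_]; first by rewrite mem_set.
by case: ifP.
Qed.

Lemma leb_box_le Q : (leb (box Q) <= (box_volume Q)%:E)%E.
Proof.
have := @leb_le_esum nat [set 0%N] (fun=> Q) (box Q).
rewrite esum_set1 ?lee_fin ?box_volume_ge0//; apply => // x ?.
by exists 0%N.
Qed.

(** The hyperplane cuts each box of a cover into [Ql Q] and [Qr Q], whose volumes add up to at most
    that of [Q]; this is the Caratheodory inequality. *)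
Lemma measurable_halfspace (i : 'I_n) (a : R) :
  measurable ([set x : V | x ord0 i < a] : set (@lebT R n)).
Proof.
apply: le_caratheodory_measurable => X /=.
apply: le_ereal_inf_tmp => _ [J [cJ XJ] <-].
pose Ql Q : V * V := (Q.1, \row_j if j == i then Num.min a (Q.2 ord0 j) else Q.2 ord0 j).
pose Qr Q : V * V := (\row_j if j == i then Num.max a (Q.1 ord0 j) else Q.1 ord0 j, Q.2).
apply: (@le_trans _ _ (\esum_(Q in J) (box_volume (Ql Q))%:E +
    \esum_(Q in J) (box_volume (Qr Q))%:E)%E).
  apply: leeD; apply: leb_le_esum => //.
    move=> x [/XJ[Q JQ Qx] /= xa]; exists Q => // j; rewrite /= mxE.
    by case: eqP => [->|_]; last exact: Qx; rewrite lt_min xa; exact: Qx.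
  move=> x [/XJ[Q JQ Qx] /= /negP]; rewrite -leNgt => xa; exists Q => // j; rewrite /= mxE.
  by case: eqP => [->|_]; last exact: Qx; rewrite ge_max xa; exact: Qx.
rewrite -esumD; [|by move=> Q _; rewrite lee_fin box_volume_ge0..].
apply: le_esum => Q _; rewrite -EFinD lee_fin.
have volE Q' : (forall j, j != i -> Q'.1 ord0 j = Q.1 ord0 j /\ Q'.2 ord0 j = Q.2 ord0 j) ->
    box_volume Q' = Num.max 0 (Q'.2 ord0 i - Q'.1 ord0 i) *
      \prod_(j < n | j != i) Num.max 0 (Q.2 ord0 j - Q.1 ord0 j).
  move=> QQ'; rewrite /box_volume (bigD1 i)//=; congr (_ * _).
  by apply: eq_bigr => j /QQ'[-> ->].
rewrite !volE//=; [|by move=> j /negbTE ji; rewrite mxE ji..].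
rewrite !mxE eqxx -mulrDl ler_wpM2r//.
  by apply: prodr_ge0 => j _; rewrite le_max lexx.
set l := Q.1 ord0 i; set u := Q.2 ord0 i.
rewrite /Num.max /Num.min; do ! case: ifP; lra.
Qed.

Lemma measurable_box Q : measurable (box Q : set (@lebT R n)).
Proof.
have -> : box Q = \bigcap_(i in [set: 'I_n])
    ([set x : V | x ord0 i < Q.2 ord0 i] `\` [set x : V | x ord0 i < Q.1 ord0 i]).
  apply/seteqP; split => [x Qx i _|x Qx i].
    by have /andP[l u] := Qx i; split => //=; apply/negP; rewrite -leNgt.
  by have [/= -> /negP] := Qx i I; rewrite -leNgt => ->.
apply: fin_bigcap_measurable => //.
by move=> i _; apply: measurableD; exact: measurable_halfspace.
Qed.

(** An open set is the union of the boxes with rational corners that it contains. The index set is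
    all pairs of rational rows, with [set0] in place of boxes that stick out. *)
Lemma open_lebesgue_measurable (U : set V) : open U -> measurable (U : set (@lebT R n)).
Proof.
move=> oU; pose Q (q : 'rV[rat]_n * 'rV[rat]_n) : V * V :=
  (map_mx ratr q.1, map_mx ratr q.2).
have -> : U = \bigcup_(q in [set: 'rV[rat]_n * 'rV[rat]_n])
    (if pselect (box (Q q) `<=` U) is left _ then box (Q q) else set0).
  apply/seteqP; split => [x Ux|x [q _]]; last by case: pselect => // h /h.
  have [e /= e0 xeU] : exists2 e : R, 0 < e & ball x e `<=` U.
    by have /nbhs_ballP[e e0 ?] := open_nbhs_nbhs (conj oU Ux); exists e.
  have /choice[a aP] : forall i, exists q : rat, ratr q \in `](x ord0 i - e), (x ord0 i)[.
    by move=> i; have := @rat_in_itvoo R (x ord0 i - e) (x ord0 i); apply; rewrite ltrBlDr ltrDl.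
  have /choice[b bP] : forall i, exists q : rat, ratr q \in `](x ord0 i), (x ord0 i + e)[.
    by move=> i; have := @rat_in_itvoo R (x ord0 i) (x ord0 i + e); apply; rewrite ltrDl.
  exists (\row_i a i, \row_i b i) => //.
  case: pselect => [_ i|nQ]; first by rewrite /= !mxE;
    have := aP i; have := bP i; rewrite !in_itv/= => /andP[-> _] /andP[_ /ltW ->].
  exfalso; apply: nQ => y Qy; apply: xeU; apply/in_ball_coord => // i.
  have := Qy i; rewrite /= !mxE; have := aP i; have := bP i; rewrite !in_itv/=.
  move=> /andP[_ h1] /andP[h2 _] /andP[h3 h4].
  by rewrite ltr_norml; apply/andP; split; lra.
apply: countable_bigcupT_measurable => [|q]; first exact: countableP.
by case: pselect => _; [exact: measurable_box|exact: measurable0].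
Qed.

Lemma eball_open (x : V) r : open (eball x r).
Proof.
pose g (y : V) : R := Num.sqrt (\sum_(i < n) (y ord0 i - x ord0 i) ^+ 2).
have -> : eball x r = g @^-1` [set t | t < r].
  have gE y : enorm (y - x) = g y by congr Num.sqrt; apply: eq_bigr => i _; rewrite !mxE.
  by apply/seteqP; split => y; rewrite /eball/= gE.
apply: open_comp; last exact: open_lt.
move=> y _; apply: continuous_comp; last exact: sqrt_continuous.
suff c : continuous (fun z : V => \sum_(i < n) (z ord0 i - x ord0 i) ^+ 2) by exact: c.
apply: continuous_big => [|i _ z]; first exact: add_continuous.
apply: (@continuous_comp _ _ _ (fun y : V => y ord0 i - x ord0 i) (fun t : R => t ^+ 2));
  last exact: exprn_continuous.
by apply: continuousB; [exact: (@coord_continuous R 1 n ord0 i z)|exact: cst_continuous].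
Qed.

Lemma leb_eball_le (x : V) r : 0 <= r -> (leb (eball x r) <= ((2 * r) ^+ n)%:E)%E.
Proof.
move=> r0.
pose Q : V * V := (\row_i (x ord0 i - r), \row_i (x ord0 i + r)).
have volQ : box_volume Q = (2 * r) ^+ n.
  rewrite /box_volume -[in RHS](card_ord n) -prodr_const; apply: eq_bigr => i _.
  by rewrite !mxE max_r; lra.
rewrite -volQ; apply: le_trans (leb_box_le Q); apply: le_outer_measure => y.
move=> /[dup] /eball_gt0 r1 /sub_eball_ball /in_ball_coord => /(_ r1) h i.
by have := h i; rewrite /= !mxE ltr_norml => /andP[? ?]; apply/andP; split; lra.
Qed.

(** The concentric cube of side [r / n.+1] lies in the ball, and the lower bound on the measure of
    boxes applies to it. *)
Lemma leb_eball_ge (x : V) r : 0 < r -> (((r / n.+1%:R) ^+ n)%:E <= leb (eball x r))%E.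
Proof.
move=> r0.
pose s := r / n.+1%:R / 2.
pose Q : V * V := (\row_i (x ord0 i - s), \row_i (x ord0 i + s)).
have rs : r / n.+1%:R = 2 * s by rewrite /s [RHS]mulrC divfK.
have s0 : 0 < 2 * s by rewrite -rs divr_gt0.
have volQ : box_volume Q = (2 * s) ^+ n.
  rewrite /box_volume -[in RHS](card_ord n) -prodr_const; apply: eq_bigr => i _.
  by rewrite !mxE max_r; lra.
rewrite rs -volQ; apply: le_trans (box_volume_le_leb Q) _; apply: le_outer_measure => y Qy.
have -> : r = n.+1%:R * (2 * s) by rewrite -rs mulrCA mulfV ?mulr1.
apply: sub_ball_eball; apply/in_ball_coord => // i.
have := Qy i; rewrite /= !mxE => /andP[? ?].
by rewrite ltr_norml; apply/andP; split; lra.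
Qed.

End lebesgue_outer.

(** * Comparison of Lebesgue measure and content *)

Section lebesgue_content.
Variables (R : realType) (n : nat) (beta : R).
Hypotheses (beta0 : 0 < beta) (betan : beta < n%:R) (omega_gt0 : 0 < omega beta).
Local Notation V := ('rV[R]_n).
Local Notation w := (omega beta).
Local Notation H := (@hcontent R n beta).
Local Notation T := (@lebT R n).

Lemma leb_le_bigcup (A : set V) (F : nat -> set V) : A `<=` \bigcup_k F k ->
  (leb A <= \sum_(k <oo) leb (F k))%E.
Proof.
move=> AF; apply: le_trans (@outer_measure_sigma_subadditive R V (@leb_outer R n) F).
exact: le_outer_measure.
Qed.

Lemma natr_powR_split (s : R) : 0 <= s -> s ^+ n = s `^ (n%:R - beta) * s `^ beta.
Proof.
move=> s0; rewrite -powRD ?subrK ?powR_mulrn//.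
by rewrite gt_eqF// (lt_trans beta0 betan).
Qed.

(* A covering ball of radius [s] contributes at most
   [2 ^+ n * minr r s ^+ n <= 2 ^+ n * r `^ (n - beta) * s `^ beta]. *)
Lemma leb_le_hcontent (x : V) (r : R) (E : set V) : 0 < r -> E `<=` eball x r ->
  (leb E <= (2 ^+ n * r `^ (n%:R - beta) / w)%:E * H E)%E.
Proof.
move=> r0 Exr; set C := 2 ^+ n * _.
have C0 : 0 < C by rewrite mulr_gt0 ?exprn_gt0 ?powR_gt0.
have Cw0 : 0 < C / w := divr_gt0 C0 omega_gt0.
rewrite -lee_pdivrMl//; apply: le_ereal_inf_tmp => _ [rho [z Erho] <-].
rewrite lee_pdivrMl//.
rewrite -nneseriesZl; last first.
  by move=> i _; rewrite lee_fin mulr_ge0 ?powR_ge0 ?omega_ge0.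
apply: (@le_trans _ _ (\sum_(i <oo) leb (E `&` eball (z i) (rho i)%:num))%E).
  apply: leb_le_bigcup.
  by move=> y /[dup] Ey /Erho[i _ yi]; exists i.
apply: lee_nneseries => // i _.
rewrite -EFinM (_ : C / w * (w * (rho i)%:num `^ beta) = C * (rho i)%:num `^ beta); last first.
  by rewrite mulrA divfK// gt_eqF.
have [le_r|lt_r] := leP (rho i)%:num r.
  apply: (@le_trans _ _ (leb (eball (z i) (rho i)%:num))).
    by apply: le_outer_measure; exact: subIsetr.
  apply: (le_trans (leb_eball_le _ _)) => //.
  rewrite lee_fin exprMn (@natr_powR_split (rho i)%:num)// mulrA.
  rewrite ler_wpM2r ?powR_ge0// ler_wpM2l ?exprn_ge0//.
  by rewrite ge0_ler_powR ?nnegrE ?subr_ge0 ?(ltW betan) ?(ltW r0).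
apply: (@le_trans _ _ (leb (eball x r))).
  by apply: le_outer_measure => y [/Exr].
apply: (le_trans (leb_eball_le _ (ltW r0))).
rewrite lee_fin exprMn (natr_powR_split (ltW r0)) mulrA ler_wpM2l ?(ltW C0)//.
by rewrite ge0_ler_powR ?nnegrE ?(ltW beta0) ?(ltW r0)// ltW.
Qed.

(** The constant in the comparison depends on the radius of a surrounding ball, hence the exhaustion
    by balls about the origin. *)
Lemma hcontent0_leb0 (A : set V) : H A = 0%E -> leb A = 0%E.
Proof.
move=> A0; apply/eqP; rewrite eq_le measure_ge0 andbT.
pose F k := A `&` eball 0 k.+1%:R.
apply: (@le_trans _ _ (\sum_(k <oo) leb (F k))%E).
  apply: leb_le_bigcup => y Ay.
  exists (Num.trunc (enorm y)) => //; split => //.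
  by rewrite /eball/= subr0 truncnS_gt.
rewrite eseries0// => k _ _; apply/eqP; rewrite eq_le measure_ge0 andbT.
have := @leb_le_hcontent 0 k.+1%:R (F k) (ltr0Sn _ _) (@subIsetr _ _ _).
suff -> : H (F k) = 0%E by rewrite mule0.
by apply/eqP; rewrite eq_le hcontent_ge0 andbT -A0 le_hcontent//; exact: subIsetl.
Qed.

Lemma leb0_measurable (A : set V) : leb A = 0%E -> measurable (A : set T).
Proof.
move=> A0; apply: le_caratheodory_measurable => X /=.
have -> : leb_outer (X `&` A) = 0%E.
  apply/eqP; rewrite eq_le outer_measure_ge0 andbT -[leRHS]A0.
  by apply: le_outer_measure; exact: subIsetr.
by rewrite add0e; apply: le_outer_measure; exact: subIsetl.
Qed.

(** Apart from [Z], which has content 0 and therefore only measurable subsets, [D] is the countable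
    union of the sets on which quasicontinuity makes [f] continuous. *)
Lemma quasicontinuous_measurable (D : set V) (f : V -> R) : quasicontinuous beta D f ->
  measurable (D : set T) /\ measurable_fun (D : set T) (f : T -> R).
Proof.
move=> [D0 qc].
have mD : measurable (D : set T).
  by rewrite -[D]setCK; apply: measurableC; apply: leb0_measurable; exact: hcontent0_leb0.
split => //.
have /choice[G GP] : forall k : nat, exists O : set V,
    [/\ open O, (H O < (k.+1%:R^-1)%:E)%E & {within D `\` O, continuous f}].
  by move=> k; apply: qc; rewrite invr_gt0.
pose Z := D `&` \bigcap_k G k.
have Zsub (A : set V) : A `<=` Z -> measurable (A : set T).
  move=> AZ; apply: leb0_measurable; apply: hcontent0_leb0.
  apply/eqP; rewrite eq_le hcontent_ge0 andbT; apply/lee_addgt0Pr => e e0.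
  rewrite add0e.
  have [k ke] : exists k : nat, k.+1%:R^-1 <= e.
    exact: exists_natinv_le.
  have [_ /ltW Ok _] := GP k; apply: (@le_trans _ _ (k.+1%:R^-1)%:E); last by rewrite lee_fin.
  by apply: le_trans Ok; apply: le_hcontent => y /AZ[_]; apply.
have mO k : measurable (G k : set T).
  by apply: open_lebesgue_measurable; have [] := GP k.
have -> : D = Z `|` \bigcup_k (D `\` G k).
  apply/seteqP; split => [y Dy|y [[]//|[k _ []]//]].
  have [h|/existsNP[k nk]] := pselect (forall k, G k y); first by left; split => // k _.
  by right; exists k.
have mDO k : measurable (D `\` G k : set T) by exact: measurableD.
apply/measurable_funU; [exact: Zsub|exact: bigcupT_measurable|split].
  by move=> _ Y mY; apply: Zsub; exact: subIsetl.
apply/measurable_fun_bigcup => // k.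
apply: (measurability _ (RGenOpens.measurableE R)) => _ [_ [a [b ->] <-]].
have oab : open (`]a, b[%classic : set R) by exact: interval_open.
have [_ _ /continuousP/(_ _ oab)] := GP k.
move=> /open_subspaceP[U oU UE]; rewrite setIC -UE.
by apply: measurableI => //; exact: open_lebesgue_measurable.
Qed.

End lebesgue_content.

(** * Choquet integrals through dyadic levels *)

Section choquet_bounds.
Variables (R : realType) (n : nat) (beta : R).
Hypothesis beta0 : 0 < beta.
Local Notation V := ('rV[R]_n).
Local Notation w := (omega beta).
Local Notation H := (@hcontent R n beta).

Let level_noninc (g : V -> \bar R) :
  {homo (fun t : R => H [set x | (t%:E < g x)%E]) : s t / s <= t >-> (t <= s)%E}.
Proof.
move=> s t st; apply: le_hcontent => x /=; apply: le_lt_trans.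
by rewrite lee_fin.
Qed.

Lemma level_restrict (A : set V) (g : V -> R) (t : R) : 0 <= t ->
  [set x | (t%:E < ((EFin \o g) \_ A) x)%E] = A `&` [set x | t < g x].
Proof.
move=> t0; apply/seteqP; split => x /=; rewrite patchE.
  by case: ifPn => [/set_mem Ax|_]; rewrite lte_fin// ltNge t0.
by move=> [Ax tx]; rewrite mem_set.
Qed.

Lemma dyadic_le_choquet (A : set V) (g : V -> R) (delta : R) : 0 < delta ->
  (\sum_(m <oo) (delta * 2 ^+ m)%:E * H (A `&` [set x | (delta * 2 ^+ m < g x)%R]) <=
  2%:E * choquet_in beta A (EFin \o g))%E.
Proof.
move=> d0; have := nneseries_dyadic_le
  (fun t => hcontent_ge0 _ [set x | (t%:E < ((EFin \o g) \_ A) x)%E]) (level_noninc _) d0.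
apply: le_trans.
apply: lee_nneseries => m *.
  by rewrite mule_ge0 ?hcontent_ge0// lee_fin mulr_ge0 ?exprn_ge0// ltW.
by rewrite level_restrict// mulr_ge0 ?exprn_ge0// ltW.
Qed.

Lemma choquet_le_dyadic (A : set V) (g : V -> R) (b : \bar R) (e : R) (K : nat) : 0 < e ->
  (H A <= b)%E ->
  (choquet_in beta A (EFin \o g) <= e%:E * b + (2 ^+ K)%:E * H (A `&` [set x | (e < g x)%R])
   + \sum_(K <= m <oo) (2 ^+ m)%:E * H (A `&` [set x | (2 ^+ m < g x)%R]))%E.
Proof.
move=> e0 Ab.
apply: (le_trans (@integral_le_dyadic _
  (fun t => H [set x | (t%:E < ((EFin \o g) \_ A) x)%E])
  (fun t => hcontent_ge0 _ _) (level_noninc _) b e K e0 _)).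
  move=> t t0; rewrite (level_restrict _ _ (ltW t0)); apply: le_trans Ab.
  by apply: le_hcontent; exact: subIsetl.
rewrite (level_restrict _ _ (ltW e0)) leeD2l//.
apply: lee_nneseries => m *.
  by rewrite mule_ge0 ?hcontent_ge0// lee_fin exprn_ge0.
by rewrite level_restrict ?exprn_ge0.
Qed.

Lemma choquet_in_ge0 (A : set V) (g : V -> \bar R) : (0 <= choquet_in beta A g)%E.
Proof. by apply: integral_ge0 => t _; exact: hcontent_ge0. Qed.

Lemma le_choquet_in (A B : set V) (g : V -> R) : A `<=` B -> (forall x, 0 <= g x) ->
  (choquet_in beta A (EFin \o g) <= choquet_in beta B (EFin \o g))%E.
Proof.
move=> AB g0; apply: ge0_le_integral => //.
- by move=> t _; exact: hcontent_ge0.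
- by apply: nonincreasing_emeasurable.
- by apply: nonincreasing_emeasurable.
move=> t _; apply: le_hcontent => x /=; rewrite !patchE.
case: ifPn => [/set_mem/AB Bx|_]; first by rewrite mem_set.
by case: ifPn => // _ /lt_le_trans; apply; rewrite lee_fin.
Qed.

Hypotheses (betan : beta < n%:R) (omega_gt0 : 0 < omega beta).

(** Values up to [delta] give the first term. On the layer from [delta * 2 ^+ m] to its double, the
    measure is bounded by the content. The factor 4 is 2 for the ratio of values within a layer,
    times 2 for the passage from the dyadic sum to the Choquet integral. *)
Lemma leb_integral_le_choquet (x : V) (r delta : R) (A : set (@lebT R n)) (g : V -> R) :
  0 < r -> 0 < delta -> A `<=` eball x r -> measurable A ->
  measurable_fun A (g : @lebT R n -> R) -> (forall y, 0 <= g y) ->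
  (\int[leb]_(y in A) (g y)%:E <= delta%:E * leb A +
     (4 * (2 ^+ n * r `^ (n%:R - beta) / w))%:E * choquet_in beta A (EFin \o g))%E.
Proof.
move=> r0 d0 Axr mA mg g0; set C := 2 ^+ n * _ / w.
have C0 : 0 <= C.
  by rewrite (divr_ge0 (mulr_ge0 _ _) (ltW omega_gt0)) ?exprn_ge0 ?powR_ge0.
have dm0 m : 0 < delta * 2 ^+ m by rewrite mulr_gt0 ?exprn_gt0.
pose c k := if k is m.+1 then 2 * (delta * 2 ^+ m) else delta.
have c0 k : 0 <= c k by case: k => [|m]; rewrite ?mulr_ge0 ?ltW// (dm0 m).
pose I k : set (@lebT R n) := if k is m.+1 then A `&` [set y | delta * 2 ^+ m < g y] else A.
have mI k : measurable (I k).
  case: k => [//|m]; rewrite /I -[[set y | _]]/(g @^-1` [set t | _ < t]).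
  by have := mg mA `]delta * 2 ^+ m, +oo[%classic (measurable_itv _); rewrite set_itvoy.
apply: (le_trans (@ge0_integral_le_cover _ _ _ leb A (fun y => (g y)%:E) (fun k => (c k)%:E) I
  mA _ _ _ _ _)) => //.
- exact/measurable_EFinP.
- by move=> y _; rewrite lee_fin.
- move=> y Ay.
  have [gd|dg] := leP (g y) delta; first by exists 0%N.
  have : exists m : nat, g y <= delta * 2 ^+ m.+1.
    exists (Num.trunc (g y / delta)); rewrite -ler_pdivrMl// mulrC.
    apply: (le_trans (ltW (truncnS_gt _))); rewrite -natrX ler_nat ltnW//.
    exact: ltn_expl.
  move=> /ex_minnP[m ym mmin]; exists m.+1; last by rewrite /= lee_fin mulrCA -exprS.
  split => //=; case: m ym mmin => [|m] ym mmin; first by rewrite expr0 mulr1.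
  by rewrite ltNge; apply/negP => /mmin; rewrite ltnn.
have lI0 k : (0 <= (c k)%:E * leb (I k))%E by rewrite mule_ge0// lee_fin.
rewrite nneseries_recl//= leeD2l//.
rewrite -(nneseries_addn 1)//.
apply: (@le_trans _ _ ((2 * C)%:E * (2%:E * choquet_in beta A (EFin \o g)))%E); last first.
  rewrite muleA -EFinM lee_wpmul2r ?choquet_in_ge0// lee_fin.
  by rewrite mulrAC -natrM.
apply: (@le_trans _ _ ((2 * C)%:E *
   \sum_(m <oo) (delta * 2 ^+ m)%:E * H (A `&` [set x | (delta * 2 ^+ m < g x)%R]))%E).
  rewrite -nneseriesZl; last first.
    by move=> m _; rewrite mule_ge0 ?hcontent_ge0// lee_fin ltW.
  apply: lee_nneseries => [m _ _|m _]; first exact: lI0.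
  rewrite addn1 muleA -EFinM (mulrAC 2) (EFinM _ C) -muleA.
  apply: lee_wpmul2l; first exact: (c0 m.+1).
  by apply: (@leb_le_hcontent _ _ _ beta0 betan omega_gt0 x r) => // y [/Axr].
apply: lee_wpmul2l; first by rewrite lee_fin mulr_ge0.
exact: dyadic_le_choquet.
Qed.

End choquet_bounds.

(** * Lebesgue points *)

Section lebesgue_points.
Variables (R : realType) (n : nat) (beta p : R) (D : set 'rV[R]_n) (f : 'rV[R]_n -> R).
Local Notation V := ('rV[R]_n).
Local Notation w := (omega beta).
Local Notation H := (@hcontent R n beta).
Hypotheses (beta0 : 0 < beta) (betan : beta < n%:R) (omega_gt0 : 0 < omega beta) (p1 : 1 <= p).

Let p0 : 0 < p. Proof. exact: lt_le_trans ltr01 p1. Qed.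

(** Such a large difference exceeds [2 * |c|], which forces [|a - c| <= 2 * |a|]. The resulting
    factor [2 ^ p] is paid for by lowering the dyadic level by [s]. *)
Lemma powR_sub_gt (a c : R) (s K m : nat) : 2 `^ p <= 2 ^+ s -> (2 * `|c|) `^ p <= 2 ^+ K ->
  (K <= m)%N -> (s <= m)%N -> 2 ^+ m < `|a - c| `^ p -> 2 ^+ (m - s) < `|a| `^ p.
Proof.
move=> ps cK Km sm ma.
have ca : 2 * `|c| < `|a - c|.
  rewrite ltNge; apply/negP => h; move: ma; rewrite ltNge => /negP; apply.
  apply: (@le_trans _ _ ((2 * `|c|) `^ p)).
    by rewrite ge0_ler_powR ?nnegrE ?mulr_ge0// ltW.
  by apply: (le_trans cK); rewrite ler_weXn2l// ler1n.
have ac : `|a - c| <= 2 * `|a|.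
  by have := ler_normB a c; lra.
rewrite -(ltr_pM2r (_ : 0 < 2 ^+ s)) ?exprn_gt0// -exprD subnK//.
apply: (lt_le_trans ma); apply: (@le_trans _ _ ((2 * `|a|) `^ p)).
  by rewrite ge0_ler_powR ?nnegrE ?mulr_ge0// ltW.
by rewrite powRM// mulrC ler_wpM2l ?powR_ge0.
Qed.

Lemma exists_expr2_ge (a : R) : exists k : nat, a <= 2 ^+ k.
Proof.
exists (Num.trunc a).+1; apply: (le_trans (ltW (truncnS_gt a))).
by rewrite -natrX ler_nat ltnW// ltn_expl.
Qed.

Variable G : nat -> set V.
Hypothesis fG : forall m, {within D `\` G m, continuous f}.
Let A m := G m `|` (D `&` [set y | 2 ^+ m < `|f y| `^ p]).

Variable x : V.
Hypothesis Dx : D x.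
Hypothesis density : forall t : R, 0 < t ->
  exists K, (forall m, (K <= m)%N -> ~ A m x) /\
    forall r : R, 0 < r ->
     (\sum_(K <= m <oo) (2 ^+ m)%:E * H (A m `&` eball x r) <= (t * r `^ beta)%:E)%E.

(* Levels below [e] cost at most [e * hcontent (eball x r)]; for small [r], points
   of level above [e] lie in some [G m] by continuity off [G m]; high dyadic levels
   of [|f - f x| ^ p] lie in the sets [A m] up to a shift of [m]. *)
Lemma choquet_oscillation (eta : R) : 0 < eta -> exists2 r0 : R, 0 < r0 &
  forall r, 0 < r -> r < r0 ->
  (choquet_in beta (eball x r `&` D) (fun y => (`|f y - f x| `^ p)%:E) <=
   (eta * r `^ beta)%:E)%E.
Proof.
move=> eta0; pose c := f x.
have p2 m : 0 < 2 ^+ m :> R by rewrite exprn_gt0.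
have div3 a : 0 < a -> a * (eta / (3 * a)) = eta / 3.
  by move=> a_gt0; field; rewrite gt_eqF.
have [s ps] := exists_expr2_ge (2 `^ p).
have [K3 cK3] := exists_expr2_ge ((2 * `|c|) `^ p).
have [K1 [_ sumK1]] := density (divr_gt0 eta0 (mulr_gt0 (ltr0n R 3) (p2 s))).
(* For [m >= K2], the shifted level [m - s] is still at least [K1], where the density bound holds,
   and [m >= K3] as [powR_sub_gt] requires. *)
pose K2 := (K1 + K3 + s)%N.
(* [K4] is chosen after [K2], because its density bound has to absorb the weight [2 ^+ K2] of the
   intermediate levels. *)
have [K4 [nA4 sumK4]] := density (divr_gt0 eta0 (mulr_gt0 (ltr0n R 3) (p2 K2))).
pose e := eta / (3 * w).
have e0 : 0 < e := divr_gt0 eta0 (mulr_gt0 (ltr0n R 3) omega_gt0).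
have term0 m r : (0 <= (2 ^+ m)%:E * H (A m `&` eball x r))%E.
  by rewrite mule_ge0 ?hcontent_ge0// lee_fin ltW.
have nGx : ~ G K4 x by move=> Gx; apply: (nA4 K4) => //; left.
have [r0 r00 fr0] : exists2 r0 : R, 0 < r0 & forall y, D y -> ~ G K4 y -> ball x r0 y ->
    `|f y - c| `^ p <= e.
  have /subspace_continuousP/(_ x (conj Dx nGx)) := @fG K4.
  move=> /cvgrPdist_le/(_ (e `^ p^-1)); rewrite powR_gt0// => /(_ isT).
  rewrite near_withinE => /nbhs_ballP[r0 /= r00 h]; exists r0 => // y Dy nGy xy.
  have /= hy := h _ xy (conj Dy nGy).
  rewrite distrC (@le_trans _ _ ((e `^ p^-1) `^ p))//.
    by rewrite ge0_ler_powR ?nnegrE ?powR_ge0// ltW.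
  by rewrite -powRrM mulVf ?powRr1 ?gt_eqF// ltW.
exists r0 => // r r_gt0 rr0; set B := eball x r `&` D.
have HB : (H B <= (w * r `^ beta)%:E)%E.
  by apply: le_trans (hcontent_eball beta0 x (ltW r_gt0)); apply: le_hcontent; exact: subIsetl.
apply: (le_trans (@choquet_le_dyadic _ _ beta B (fun y => `|f y - c| `^ p) _ e K2 e0 HB)).
have -> : (eta * r `^ beta)%:E = ((eta / 3 * r `^ beta)%:E + (eta / 3 * r `^ beta)%:E +
    (eta / 3 * r `^ beta)%:E)%E.
  by rewrite -!EFinD; congr EFin; lra.
apply: leeD; first apply: leeD.
- rewrite -EFinM lee_fin mulrA ler_wpM2r ?powR_ge0// /e le_eqVlt; apply/orP; left; apply/eqP.
  by rewrite -[RHS](div3 w)// mulrC.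
- have -> : eta / 3 * r `^ beta = 2 ^+ K2 * (eta / (3 * 2 ^+ K2) * r `^ beta).
    by rewrite mulrA div3.
  rewrite EFinM lee_pmul2l ?lte_fin//; apply: le_trans (sumK4 _ r_gt0).
  (* Only the term [m = K4] of the density series is used, and its weight is at least 1. *)
  apply: (@le_trans _ _ ((2 ^+ K4)%:E * H (A K4 `&` eball x r))%E).
    apply: (@le_trans _ _ (H (A K4 `&` eball x r))).
      apply: le_hcontent => y [[xy Dy] /= ey]; split => //; left.
      apply: contrapT => nGy; move: ey; rewrite ltNge => /negP; apply; apply: fr0 => //.
      by apply: le_ball (ltW rr0) _ _; exact: sub_eball_ball.
    by rewrite lee_pemull ?hcontent_ge0// lee_fin exprn_ege1// ler1n.
  rewrite (nneseries_split K4 1); last by move=> k _; exact: term0.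
  by rewrite addn1 big_nat1 leeDl//; apply: nneseries_ge0 => k _ _; exact: term0.
have -> : eta / 3 * r `^ beta = 2 ^+ s * (eta / (3 * 2 ^+ s) * r `^ beta).
  by rewrite mulrA div3.
apply: (@le_trans _ _ ((2 ^+ s)%:E *
    \sum_(K1 + K3 <= m <oo) (2 ^+ m)%:E * H (A m `&` eball x r))%E); last first.
  rewrite [leRHS]EFinM lee_pmul2l ?lte_fin//; apply: le_trans (sumK1 _ r_gt0).
  rewrite !ereal_series; apply: subset_lee_nneseries => [m _|m]; first exact: term0.
  by apply: leq_trans; exact: leq_addr.
rewrite -nneseriesZl; last by move=> m _; exact: term0.
rewrite -(nneseries_addn K2); last first.
  by move=> m; rewrite mule_ge0 ?hcontent_ge0// lee_fin ltW.
rewrite -(nneseries_addn (K1 + K3)); last first.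
  by move=> m; rewrite mule_ge0// lee_fin ltW.
apply: lee_nneseries => m *; first by rewrite mule_ge0 ?hcontent_ge0// lee_fin ltW.
rewrite muleA -EFinM -exprD /K2 addnA [(s + _)%N]addnC lee_pmul2l ?lte_fin//.
apply: le_hcontent => y [[xy Dy] /= my]; split => //; right; split => //=.
have K3m : (K3 <= m + (K1 + K3) + s)%N.
  exact: leq_trans (leq_trans (leq_addl K1 K3) (leq_addl m _)) (leq_addr s _).
have := powR_sub_gt ps cK3 K3m (leq_addl _ _) my.
by rewrite addnK.
Qed.

End lebesgue_points.

(** * Convergence of Lebesgue averages *)

Section averages.
Variables (R : realType) (n : nat) (beta p : R) (D : set 'rV[R]_n) (f : 'rV[R]_n -> R).
Local Notation V := ('rV[R]_n).
Local Notation T := (@lebT R n).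
Local Notation w := (omega beta).
Local Notation H := (@hcontent R n beta).
Hypotheses (beta0 : 0 < beta) (betan : beta < n%:R) (omega_gt0 : 0 < omega beta) (p1 : 1 <= p).

(** Above [e], [a ^ p >= e ^ (p - 1) * a] because [p >= 1]. This takes the place of Hölder's
    inequality in passing from exponent [p] to exponent 1. *)
Lemma le_add_powR (a e : R) : 0 <= a -> 0 < e -> a <= e + (e `^ (p - 1))^-1 * a `^ p.
Proof.
move=> a0 e0; have k0 : 0 < e `^ (p - 1) by rewrite powR_gt0.
have [ae|ea] := leP a e.
  by rewrite (le_trans ae)// lerDl mulr_ge0 ?invr_ge0 ?powR_ge0.
have a_gt0 := lt_trans e0 ea.
apply: (@le_trans _ _ ((e `^ (p - 1))^-1 * a `^ p)); last by rewrite lerDr ltW.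
rewrite mulrC ler_pdivlMr//.
have -> : a `^ p = a * a `^ (p - 1).
  have := @powRD R a 1 (p - 1); rewrite (addrC 1) subrK powRr1//; apply.
  by rewrite (gt_eqF a_gt0) implybT.
by rewrite ler_pM2l// ge0_ler_powR ?nnegrE ?subr_ge0// ltW.
Qed.

Hypotheses (mD : measurable (D : set T)) (mf : measurable_fun (D : set T) (f : T -> R)).

Lemma leb_integral_abs_le (x : V) (r e delta c : R) : 0 < r -> 0 < e -> 0 < delta ->
  (\int[leb]_(y in (eball x r `&` D : set T)) (`|f y - c|)%:E <=
   (e + (e `^ (p - 1))^-1 * delta)%:E * leb (eball x r) +
   ((e `^ (p - 1))^-1 * (4 * (2 ^+ n * r `^ (n%:R - beta) / w)))%:E *
     choquet_in beta (eball x r `&` D) (fun y => (`|f y - c| `^ p)%:E))%E.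
Proof.
move=> r0 e0 d0; set k := (e `^ (p - 1))^-1; set C := 4 * _.
have k0 : 0 < k by rewrite invr_gt0 powR_gt0.
set A : set T := eball x r `&` D.
have mB : measurable (eball x r : set T) by apply: open_lebesgue_measurable; exact: eball_open.
have mA : measurable A by exact: measurableI.
have mfA : measurable_fun A (f : T -> R) by apply: measurable_funS mf => // y [].
have mabs : measurable_fun A (fun y : T => `|f y - c|).
  exact: (measurableT_comp (@normr_measurable R setT) (measurable_funB mfA (measurable_cst c))).
have mpow : measurable_fun A (fun y : T => (`|f y - c| `^ p)).
  exact: (measurableT_comp (measurable_powR p) mabs).
have mabsE : measurable_fun A (fun y : T => (`|f y - c|)%:E) by exact/measurable_EFinP.
have mpowE : measurable_fun A (fun y : T => (`|f y - c| `^ p)%:E) by exact/measurable_EFinP.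
have mkE : measurable_fun A (fun y : T => k%:E * (`|f y - c| `^ p)%:E)%E.
  exact: measurable_funeM.
have leA : (leb A <= leb (eball x r))%E by apply: le_outer_measure; exact: subIsetl.
have g0 (y : V) : 0 <= `|f y - c| `^ p by exact: powR_ge0.
have g0E (y : V) : (0 <= (`|f y - c| `^ p)%:E)%E by rewrite lee_fin.
have eE (y : T) : A y -> (0 <= cst e%:E y)%E by move=> _; rewrite lee_fin ltW.
have kgE (y : T) : A y -> (0 <= k%:E * (`|f y - c| `^ p)%:E)%E.
  by move=> _; rewrite mule_ge0// lee_fin ltW.
apply: (@le_trans _ _ (\int[leb]_(y in A) (cst e%:E y + k%:E * (`|f y - c| `^ p)%:E))%E).
  apply: (ge0_le_integral _ mA _ mabsE).
  - by move=> y _; rewrite lee_fin.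
  - exact: (emeasurable_funD (measurable_cst _) mkE).
  - by move=> y _; rewrite -EFinM -EFinD lee_fin; exact: le_add_powR.
rewrite (ge0_integralD _ mA eE (measurable_cst _) kgE mkE).
rewrite (integral_cst _ mA) (ge0_integralZl_EFin _ mA (fun y _ => g0E y) mpowE (ltW k0)).
have := leb_integral_le_choquet beta0 betan omega_gt0 r0 d0 (@subIsetl _ _ _) mA mpow g0.
move=> /(lee_wpmul2l (_ : 0 <= k%:E)%E) h.
apply: (le_trans (leeD (lexx _) (h _))); first by rewrite lee_fin ltW.
rewrite -/C; have C0 : 0 <= C.
  by rewrite mulr_ge0// (divr_ge0 (mulr_ge0 _ _) (ltW omega_gt0)) ?exprn_ge0 ?powR_ge0.
set ch := choquet_in beta A _.
have ch0 : (0 <= ch)%E := choquet_in_ge0 beta A _.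
have lA0 : (0 <= leb A)%E := measure_ge0 leb A.
have dE : (0 <= delta%:E)%E by rewrite lee_fin ltW.
have CE : (0 <= C%:E)%E by rewrite lee_fin.
rewrite (ge0_muleDr _ (mule_ge0 dE lA0) (mule_ge0 CE ch0)) !muleA -!EFinM addeA.
apply: leeD2r; have kd0 : (0 <= (k * delta)%:E)%E by rewrite lee_fin ltW// mulr_gt0.
have eE' : (0 <= e%:E)%E by rewrite lee_fin ltW.
rewrite -(ge0_muleDl _ eE' kd0) -EFinD; apply: lee_wpmul2l => //.
by rewrite EFinD adde_ge0.
Qed.

Let average_const (e k v P N a b : R) : k != 0 -> v != 0 -> P != 0 -> N != 0 ->
  k * (4 * (P * a / v)) * (e / (3 * k * (4 * (P * N) / v)) * b) = e / 3 * (a * b / N).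
Proof. by move=> k0 v0 P0 N0; field; rewrite k0 v0 P0 N0. Qed.

Let cancel3 (e k : R) : k != 0 -> k * (e / (3 * k)) = e / 3.
Proof. by move=> k0; field. Qed.

Hypothesis D0 : leb (~` D : set T) = 0%E.

Lemma average_cvg (x : V) (c : R) :
  (forall r, 0 < r -> leb.-integrable (eball x r `&` D : set T) (EFin \o f)) ->
  (forall eta : R, 0 < eta -> exists2 r0 : R, 0 < r0 & forall r, 0 < r -> r < r0 ->
    (choquet_in beta (eball x r `&` D) (fun y => (`|f y - c| `^ p)%:E) <=
     (eta * r `^ beta)%:E)%E) ->
  average D f x r @[r --> 0^'+] --> c.
Proof.
move=> intf osc; apply/cvgrPdist_le => e e0.
pose e1 := e / 3; have e1_gt0 : 0 < e1 by rewrite divr_gt0.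
pose k := (e1 `^ (p - 1))^-1; have k0 : 0 < k by rewrite invr_gt0 powR_gt0.
(* [M] collects the constants of the comparison with content and the factor [n.+1 ^ n] between
   [r ^ n] and the measure of the ball. With it, each of the three error terms is at most a third of
   [e] times that measure. *)
pose M := 4 * (2 * n.+1%:R) ^+ n / w.
have M0 : 0 < M := divr_gt0 (mulr_gt0 (ltr0n R 4)
  (exprn_gt0 n (mulr_gt0 (ltr0n R 2) (ltr0n R n.+1)))) omega_gt0.
have d0 : 0 < e / (3 * k) := divr_gt0 e0 (mulr_gt0 (ltr0n R 3) k0).
have eta0 : 0 < e / (3 * k * M) := divr_gt0 e0 (mulr_gt0 (mulr_gt0 (ltr0n R 3) k0) M0).
have [r0 r00 hr0] := osc _ eta0.
near=> r.
have r_gt0 : 0 < r by near: r; exact: nbhs_right_gt.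
have rr0 : r < r0 by near: r; exact: nbhs_right_lt.
set A : set T := eball x r `&` D.
have mB : measurable (eball x r : set T) by apply: open_lebesgue_measurable; exact: eball_open.
have mA : measurable A by exact: measurableI.
pose mu := fine (leb (eball x r)).
have muE : leb (eball x r) = mu%:E.
  rewrite /mu fineK// ge0_fin_numE ?measure_ge0//.
  by apply: le_lt_trans (leb_eball_le _ (ltW r_gt0)) _; rewrite ltry.
have muge : (r / n.+1%:R) ^+ n <= mu.
  by rewrite -lee_fin -muE; exact: leb_eball_ge.
have mu0 : 0 < mu by apply: lt_le_trans muge; rewrite exprn_gt0// divr_gt0.
(* The average divides by the measure of the full ball but integrates over its part in [D]; as the
   complement of [D] is null, the constant [c] has average exactly [c]. *)
have AE : leb A = mu%:E.
  rewrite -muE; have -> : leb (eball x r) = (leb A + leb (eball x r `&` ~` D))%E := mD (eball x r).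
  have -> : leb (eball x r `&` ~` D) = 0%E.
    apply/eqP; rewrite eq_le measure_ge0 andbT -[leRHS]D0.
    by apply: le_outer_measure; exact: subIsetr.
  by rewrite adde0.
have intc : leb.-integrable A (EFin \o cst c).
  apply/integrableP; split; first exact/measurable_EFinP/measurable_cst.
  rewrite [ltLHS](integral_cst _ mA `|c|%:E) [X in (_ * X)%E]AE.
  by rewrite -EFinM ltry.
have intfc : leb.-integrable A (EFin \o (fun y => f y - c)).
  exact: (integrableB mA (intf _ r_gt0) intc).
have avgE : average D f x r - c = mu^-1 * (\int[leb]_(y in A) (f y - c))%R.
  rewrite (RintegralB mA (intf _ r_gt0) intc).
  have -> : (\int[leb]_(y in A) c)%R = c * mu.
    by rewrite (Rintegral_cst _ mA); congr (_ * _); exact: (congr1 fine AE).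
  rewrite mulrBr; congr (_ - _).
  by rewrite mulrC mulfK// gt_eqF.
rewrite distrC avgE normrM gtr0_norm ?invr_gt0// mulrC ler_pdivrMr//.
apply: (le_trans (le_normr_Rintegral mA intfc)).
suff h : (\int[leb]_(y in A) (`|f y - c|)%:E <= (e * mu)%:E)%E.
  rewrite -lee_fin /Rintegral fineK// ge0_fin_numE; last first.
    by apply: integral_ge0 => y _; rewrite lee_fin.
  by apply: (le_lt_trans h); rewrite ltry.
apply: (le_trans (leb_integral_abs_le x c r_gt0 e1_gt0 d0)).
rewrite -/A -/k muE; apply: (@le_trans _ _ (((e1 + k * (e / (3 * k))) * mu)%:E +
   (k * (4 * (2 ^+ n * r `^ (n%:R - beta) / w)) * (e / (3 * k * M) * r `^ beta))%:E)%E).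
  rewrite -EFinM; apply: leeD2l; rewrite [leRHS]EFinM; apply: lee_wpmul2l; last exact: hr0.
  rewrite lee_fin mulr_ge0 ?(ltW k0)// mulr_ge0//.
  by rewrite (divr_ge0 (mulr_ge0 _ _) (ltW omega_gt0)) ?exprn_ge0 ?powR_ge0.
rewrite -EFinD lee_fin.
have rn : r `^ (n%:R - beta) * r `^ beta <= mu * n.+1%:R ^+ n.
  by rewrite -(natr_powR_split beta0 betan (ltW r_gt0)) -ler_pdivrMr ?exprn_gt0// -expr_div_n.
have -> : k * (4 * (2 ^+ n * r `^ (n%:R - beta) / w)) * (e / (3 * k * M) * r `^ beta) =
    e / 3 * (r `^ (n%:R - beta) * r `^ beta / n.+1%:R ^+ n).
  by rewrite /M exprMn average_const ?expf_neq0// ?lt0r_neq0.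
have -> : k * (e / (3 * k)) = e / 3.
  by rewrite cancel3// lt0r_neq0.
have h : e / 3 * (r `^ (n%:R - beta) * r `^ beta / n.+1%:R ^+ n) <= e / 3 * mu.
  by rewrite ler_pM2l ?divr_gt0// ler_pdivrMr ?exprn_gt0.
by apply: le_trans (lerD (lexx _) h) _; rewrite /e1 -!mulrDl; lra.
Unshelve. all: by end_near.
Qed.

End averages.

(* Covers the case where the integral defining [gamma (beta / 2 + 1)] would be
   infinite, for which [fine] and the division give [omega beta = 0]. *)
Lemma hcontent_omega0 (R : realType) (n : nat) (beta : R) (E : set 'rV[R]_n) :
  omega beta = 0 -> hcontent beta E = 0%E.
Proof.
move=> w0; apply/eqP; rewrite eq_le hcontent_ge0 andbT.
apply: ereal_inf_lbound; exists (fun i => i.+1%:R%:nng).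
  exists (fun=> 0) => y _; exists (Num.trunc (enorm y)) => //.
  by rewrite /eball/= subr0 truncnS_gt.
by rewrite eseries0// => i _ _; rewrite w0 mul0r.
Qed.

(** * Integrability and almost every Lebesgue point *)

Section conclusion.
Variables (R : realType) (n : nat) (beta p : R) (D : set 'rV[R]_n) (f : 'rV[R]_n -> R).
Local Notation V := ('rV[R]_n).
Local Notation T := (@lebT R n).
Local Notation w := (omega beta).
Local Notation H := (@hcontent R n beta).
Hypotheses (beta0 : 0 < beta) (betan : beta < n%:R) (omega_gt0 : 0 < omega beta) (p1 : 1 <= p).
Hypothesis fLp : Lp_content beta p D f.

Let p0 : 0 < p. Proof. exact: lt_le_trans ltr01 p1. Qed.

Let choquet_fin : (choquet_in beta D (fun y => (`|f y| `^ p)%:E) < +oo)%E.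
Proof. by have [_] := fLp; apply: lty_poweRy; rewrite invr_eq0 gt_eqF. Qed.

Let mDf := quasicontinuous_measurable beta0 betan omega_gt0 fLp.1.

Lemma Lp_integrable (x : V) (r : R) : 0 < r ->
  leb.-integrable (eball x r `&` D : set T) (EFin \o f).
Proof.
move=> r0; apply/integrableP; split.
  exact/measurable_EFinP/(measurable_funS mDf.1 (@subIsetr _ _ _) mDf.2).
(* With [c = 0] and [e = delta = 1], the oscillation bound becomes a bound on the integral of
   [|f|]. *)
have := leb_integral_abs_le beta0 betan omega_gt0 p1 mDf.1 mDf.2 x 0 r0 ltr01 ltr01.
under eq_integral do rewrite subr0.
move=> h; apply: (le_lt_trans h).
rewrite (_ : (fun y => ((`|f y - 0| `^ p)%R)%:E) = EFin \o (fun y => `|f y| `^ p)); last first.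
  by apply/funext => y; rewrite subr0.
have ch : (choquet_in beta (eball x r `&` D) (EFin \o (fun y => `|f y| `^ p)%R) < +oo)%E.
  apply: le_lt_trans choquet_fin; apply: le_choquet_in; first exact: subIsetr.
  by move=> y; exact: powR_ge0.
have k0 : 0 <= (1 `^ (p - 1))^-1 :> R by rewrite invr_ge0 powR_ge0.
apply: lte_add_pinfty; apply: lte_mul_pinfty => //.
- by apply: le_lt_trans (leb_eball_le _ (ltW r0)) _; rewrite ltry.
- rewrite lee_fin mulr_ge0// mulr_ge0//.
  by rewrite (divr_ge0 (mulr_ge0 _ _) (ltW omega_gt0)) ?exprn_ge0 ?powR_ge0.
Qed.

Lemma Lp_lebesgue_points :
  exists2 N : set V, H N = 0%E & forall x, ~ N x -> D x /\
    forall eta : R, 0 < eta -> exists2 r0 : R, 0 < r0 & forall r, 0 < r -> r < r0 ->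
    (choquet_in beta (eball x r `&` D) (fun y => (`|f y - f x| `^ p)%:E) <=
     (eta * r `^ beta)%:E)%E.
Proof.
have [[D0 qc] _] := fLp.
have p2 m : 0 < 2 ^+ m :> R by rewrite exprn_gt0.
have /choice[G GP] : forall m : nat, exists O : set V,
    [/\ open O, (H O < (2 ^- m * (1 / (2 ^ m.+1)%:R))%:E)%E & {within D `\` O, continuous f}].
  by move=> m; apply: qc; rewrite mulr_gt0 ?invr_gt0 ?divr_gt0 ?ltr0n ?expn_gt0.
pose E m : set V := D `&` [set y | 2 ^+ m < `|f y| `^ p].
have : (\sum_(m <oo) (2 ^+ m)%:E * H (G m `|` E m) < +oo)%E.
  apply: (@le_lt_trans _ _ (\sum_(m <oo)
      ((2 ^+ m)%:E * H (E m) + (1 / (2 ^ m.+1)%:R)%:E))%E).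
    apply: lee_nneseries => m *; first by rewrite mule_ge0 ?hcontent_ge0// lee_fin ltW.
    have [_ /ltW Gm _] := GP m.
    apply: (@le_trans _ _ ((2 ^+ m)%:E * (H (E m) + H (G m)))%E).
      by rewrite lee_pmul2l ?lte_fin// addeC hcontentU.
    rewrite ge0_muleDr ?hcontent_ge0//; apply: leeD2l.
    apply: (le_trans (lee_wpmul2l _ Gm)); first by rewrite lee_fin ltW.
    by rewrite -EFinM mulVKf// gt_eqF.
  apply: le_lt_trans (epsilon_trick _ _ ler01) _.
    by move=> m; rewrite mule_ge0 ?hcontent_ge0// lee_fin ltW.
  apply: lte_add_pinfty; last exact: ltry.
  have := dyadic_le_choquet beta D (fun y => `|f y| `^ p) (@ltr01 R).
  under eq_eseriesr do rewrite mul1r.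
  move=> /le_lt_trans; apply; apply: lte_mul_pinfty => //.
move=> /(hcontent_density beta0)[N0 N00 N0P].
exists (N0 `|` ~` D).
  apply/eqP; rewrite eq_le hcontent_ge0 andbT (le_trans (hcontentU beta0 _ _))//.
  by rewrite N00 D0 adde0.
move=> x /not_orP[nN0 /contrapT Dx]; split => //.
have fG m : {within D `\` G m, continuous f} by have [] := GP m.
exact: (choquet_oscillation beta0 omega_gt0 p1 fG Dx (N0P x nN0)).
Qed.

End conclusion.

Theorem corollary1p3 (R : realType) (n : nat) (beta p : R)
    (D : set 'rV[R]_n) (f : 'rV[R]_n -> R) :
  0 < beta -> beta < n%:R -> 1 <= p ->
  Lp_content beta p D f ->
  exists2 N : set 'rV[R]_n, hcontent beta N = 0%E &
    forall x, ~ N x ->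
      [/\ forall r : R, 0 < r ->
            leb.-integrable (eball x r `&` D) (EFin \o f),
          cvg (average D f x r @[r --> 0^'+]) &
          ((omega beta * r `^ beta)^-1%:E *
             choquet_in beta (eball x r `&` D)
               (fun y => (`|f y - fstar D f x| `^ p)%:E))%E
            @[r --> 0^'+] --> 0%E].
Proof.
move=> beta0 betan p1 fLp.
have := omega_ge0 beta; rewrite le_eqVlt => /predU1P[w0|w0].
  exists setT; first exact/hcontent_omega0/esym.
  by move=> x /(_ Logic.I).
have [N HN NP] := Lp_lebesgue_points beta0 w0 p1 fLp.
exists N => // x /NP[Dx osc].
have intf := Lp_integrable beta0 betan w0 p1 fLp x.
have [mD mf] := quasicontinuous_measurable beta0 betan w0 fLp.1.
have D0 : leb (~` D : set (@lebT R n)) = 0%E.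
  by apply: (hcontent0_leb0 beta0 betan w0); have [[]] := fLp.
have avg := average_cvg beta0 betan w0 p1 mD mf D0 intf osc.
have -> : fstar D f x = f x by apply/cvg_lim.
split; [exact: intf|by apply/cvg_ex; exists (f x)|].
(* The quotient is extended-real valued: the bound with [e = 1] shows that it is eventually finite,
   and arbitrary [e] gives the limit. *)
have key (e : R) : 0 < e -> \forall r \near 0^'+,
    (0 <= (omega beta * r `^ beta)^-1%:E * choquet_in beta (eball x r `&` D)
       (fun y => (`|f y - f x| `^ p)%:E) <= e%:E)%E.
  move=> e0; have [r0 r00 hr0] := osc _ (mulr_gt0 e0 w0).
  near=> r; have r_gt0 : 0 < r by near: r; exact: nbhs_right_gt.
  have rr0 : r < r0 by near: r; exact: nbhs_right_lt.
  have c0 : 0 < omega beta * r `^ beta := mulr_gt0 w0 (powR_gt0 _ r_gt0).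
  rewrite mule_ge0 ?choquet_in_ge0 ?lee_fin ?invr_ge0 ?(ltW c0)//=.
  rewrite lee_pdivrMl// -EFinM mulrC mulrA; exact: hr0.
apply/fine_cvgP; split.
  apply: filterS (key 1 ltr01) => r /andP[l u].
  by rewrite ge0_fin_numE// (le_lt_trans u)// ltry.
apply/cvgrPdist_le => e e0; apply: filterS (key e e0) => r /andP[l u].
rewrite sub0r normrN ger0_norm ?fine_ge0// -lee_fin fineK//.
by rewrite ge0_fin_numE// (le_lt_trans u)// ltry.
Unshelve. all: by end_near.
Qed.
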